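(* There exists a real number $x_0$ such that for every prime $p\ge x_0$ there exists a Pythagorean triple $(a_p,b_p,c_p)$ with $a_p,b_p,c_p\in\mathbb{Z}\cap(0,p)$ such that $a_pb_p/2$ is a primitive root modulo $p$.
   Context: A Pythagorean triple is a triple $(a,b,c)$ of positive integers with $a^2+b^2=c^2$ (in any such triple $ab$ is even, so $ab/2$ is an integer). For a prime $p$, an integer $m$ is a primitive root modulo $p$ if its residue class modulo $p$ is a generator of the cyclic multiplicative group $\mathbb{F}_p^*=(\mathbb{Z}/p\mathbb{Z})\setminus\{0\}$. *)

(* Defs.v *)
From mathcomp Require Import all_boot all_order all_algebra all_fingroup all_solvable.
From mathcomp Require Import reals.

Set Implicit Arguments.
Unset Strict Implicit.
Unset Printing Implicit Defensive.

Import Order.TTheory GRing.Theory Num.Theory.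
Local Open Scope ring_scope.

Definition pythagorean_triple (a b c : int) : Prop :=
  [/\ 0 < a, 0 < b, 0 < c & a ^+ 2 + b ^+ 2 = c ^+ 2].

(* Meant for prime p: 'F_p is Z/qZ for q the least prime factor of p.
   In particular m must be nonzero mod p, since its class is that of a unit. *)
Definition primitive_root (p : nat) (m : int) : Prop :=
  exists2 u : {unit 'F_p}, FinRing.uval u = m%:~R & generator [set: {unit 'F_p}] u.

(* Main.v *)
Require Import Defs.
From mathcomp Require Import all_boot all_order all_algebra all_fingroup all_solvable.
From mathcomp Require Import reals.
From mathcomp Require Import all_field zify ring.
Import Order.TTheory GRing.Theory Num.Theory.
Local Open Scope ring_scope.

Set Implicit Arguments.
Unset Strict Implicit.
Unset Printing Implicit Defensive.

(** Scale the triple generated by [u > v] by [k]: its area is [k ^ 2 * A] with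
    [A = u v (u - v) (u + v)]. If [q >= 3] is the least quadratic nonresidue, the
    choice [(u, v) = (q - 1, 1)] makes [A] a nonresidue (for [q = 2] one of the
    areas 6, 30, 60 is), so that [k ^ 2 * A] only has to avoid the [l]-th powers
    for the odd primes [l] dividing [p - 1]. Additive Fourier analysis produces
    such a [k], of the form [x + y] with [x, y <= K], as soon as [K] exceeds
    [p ^ (1/2 + epsilon)]; there is room for this if [q < p ^ (1/4 - epsilon)].

    That bound on [q] is Burgess's: if all [n <= p ^ (1/4 - epsilon)] are residues,
    then few [n <= p ^ (1/4 + epsilon)] are nonresidues, since those have a large
    prime factor. Hence more than [p ^ (1/2 + epsilon)] fractions [x = u / v] are
    such that [x + h] is a residue for most of [h = 1, ..., H]. This contradicts an
    upper bound for the high moments of the short character sums, which follows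
    from Stepanov's bound on the number of points of [y ^ 2 = f x].

    Scales are powers of [t = 2 ^ s], with [p] about [t ^ (4 * a + 4)], [a] a
    large constant, and [p ^ (1/4 - epsilon)] about [t ^ a]. *)

(** * Stepanov's method *)

Lemma size_polyM_bound (R : nzSemiRingType) (f g : {poly R}) (m n k : nat) :
  (size f <= m -> size g <= n -> m + n <= k.+1 -> size (f * g)%R <= k)%N.
Proof. by move=> fm gn mnk; apply: leq_trans (size_polyMleq f g) _; lia. Qed.

Lemma size_polyX_bound (R : nzSemiRingType) (f : {poly R}) (m n : nat) :
  (size f <= m -> size (f ^+ n)%R <= (m.-1 * n).+1)%N.
Proof. by move=> fm; apply: leq_trans (size_poly_exp_leq f n) _; nia. Qed.

Lemma pchar_prime_card (F : finFieldType) p : prime p -> #|F| = p -> p \in [pchar F].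
Proof. by move=> pp cF; apply: (@card_finPcharP F p 1); rewrite ?expn1. Qed.

Lemma poly_eq_head (R : nzRingType) (f : {poly R}) :
  exists g, f = (f.[0])%:P + 'X * g.
Proof.
elim/poly_ind: f => [|f c [g _]]; first by exists 0; rewrite horner0 mulr0 addr0.
by exists f; rewrite hornerMXaddC mulr0 add0r addrC commr_polyX.
Qed.

(* Comparing the orders at [z], where [f] has a simple zero, shows that
   [r ^+ 2 * f] is never a constant times a square. *)
Lemma stepanov_indep_head (F : finFieldType) (c D : nat) (f r s : {poly F}) (z : F) :
  prime c.*2.+1 -> #|F| = c.*2.+1 -> f.[0] != 0 -> mup z f = 1%N -> (0 < D)%N ->
  (D.*2 + size f <= c.*2.+2)%N -> (size r <= D)%N -> (size s <= D)%N ->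
  'X^(c.*2.+1) %| r + s * f ^+ c -> r = 0 /\ s = 0.
Proof.
set p := c.*2.+1 => pp cF f0 mf D0 sD sr ss dv.
have pch := pchar_prime_card pp cF.
have f_n0 : f != 0 by apply: contraNneq f0 => ->; rewrite horner0.
have sf : (1 < size f)%N.
  rewrite ltnNge; apply/negP => /size1_polyC fE.
  by move: mf; rewrite mupNroot // rootE fE hornerC -[f`_0](hornerC _ 0) -fE.
have [g fg] := poly_eq_head f.
have fp : f ^+ p = (f.[0] ^+ p)%:P + 'X^p * g ^+ p.
  have pchP : p \in [pchar {poly F}] by rewrite pchar_poly.
  rewrite {1}fg -(pFrobenius_autE pchP) pFrobenius_autD_comm; last exact: mulrC.
  by rewrite !pFrobenius_autE -polyC_exp exprMn.
(* Multiplying by [(r - s * f ^+ c) * f] produces [r ^+ 2 * f - s ^+ 2 * f ^+ p], and Frobenius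
   makes [f ^+ p] a constant modulo ['X^p]. The degree is then below [p], so the difference is 0. *)
have dv2 : 'X^p %| r ^+ 2 * f - s ^+ 2 * (f.[0] ^+ p)%:P.
  have -> : r ^+ 2 * f - s ^+ 2 * (f.[0] ^+ p)%:P =
     (r + s * f ^+ c) * ((r - s * f ^+ c) * f) + 'X^p * (s ^+ 2 * g ^+ p).
    have -> : (f.[0] ^+ p)%:P = f ^+ p - 'X^p * g ^+ p by rewrite fp addrK.
    have -> : f ^+ p = f * (f ^+ c) ^+ 2 by rewrite -exprM muln2 -exprS.
    ring.
  by rewrite dvdp_add ?dvdp_mulr.
have sX : size ('X^p : {poly F}) = p.+1 by rewrite size_polyXn.
have sz : (size (r ^+ 2 * f - s ^+ 2 * (f.[0] ^+ p)%:P)%R <= p)%N.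
  apply: (leq_trans (size_polyD _ _)); rewrite size_polyN geq_max; apply/andP; split.
    by apply: (size_polyM_bound (size_polyX_bound 2 sr) (leqnn _)); rewrite /p; lia.
  apply: (size_polyM_bound (size_polyX_bound 2 ss) (size_polyC_leq1 _)).
  by rewrite /p; lia.
have /eqP : r ^+ 2 * f - s ^+ 2 * (f.[0] ^+ p)%:P = 0.
  apply/eqP; apply: contraLR dv2 => nz; apply/negP => /(dvdp_leq nz).
  by rewrite sX ltnNge sz.
rewrite subr_eq0 => /eqP E.
have c0 : (f.[0] ^+ p)%:P != 0 :> {poly F} by rewrite polyC_eq0 expf_eq0 (negPf f0) andbF.
have [r0|rn0] := eqVneq r 0.
  split=> //; apply/eqP; move/eqP: E; rewrite r0 expr0n mul0r eq_sym mulf_eq0 (negPf c0) orbF.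
  by rewrite expf_eq0.
have [s0|sn0] := eqVneq s 0.
  move/eqP: E; rewrite s0 expr0n mul0r mulf_eq0 (negPf f_n0) orbF.
  by rewrite expf_eq0 (negPf rn0).
have /(congr1 (mup z)) := E.
rewrite !mupM ?expf_neq0 // mf (_ : mup z _%:P = 0%N); last first.
  by rewrite mupNroot // rootE hornerC expf_eq0 (negPf f0) andbF.
lia.
Qed.

(** By induction on [J]: with [p = c.*2.+1], only the term [j = 0] survives modulo ['X^p]; the
    previous lemma kills it, and a factor ['X^p] cancels. *)
Lemma stepanov_indep (F : finFieldType) (c D : nat) (f : {poly F}) (z : F) :
  prime c.*2.+1 -> #|F| = c.*2.+1 -> f.[0] != 0 -> mup z f = 1%N -> (0 < D)%N ->
  (D.*2 + size f <= c.*2.+2)%N ->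
  forall (J : nat) (r s : 'I_J -> {poly F}),
  (forall j, size (r j) <= D)%N -> (forall j, size (s j) <= D)%N ->
  \sum_(j < J) (r j + s j * f ^+ c) * 'X^(c.*2.+1 * j) = 0 ->
  forall j, r j = 0 /\ s j = 0.
Proof.
move=> pp cF f0 mf D0 sD; elim=> [|J IH] r s sr ss; first by move=> _ [].
set p := c.*2.+1.
rewrite big_ord_recl muln0 expr0 mulr1 => E.
have {E} E : (r ord0 + s ord0 * f ^+ c) +
   'X^p * \sum_(j < J) (r (lift ord0 j) + s (lift ord0 j) * f ^+ c) * 'X^(p * j) = 0.
  rewrite -[RHS]E; congr (_ + _); rewrite mulr_sumr; apply: eq_bigr => j _.
  by rewrite [LHS]mulrCA -exprD -mulnS.
have H0 : r ord0 = 0 /\ s ord0 = 0.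
  apply: (stepanov_indep_head pp cF f0 mf D0 sD) => //.
  by move/eqP: E; rewrite addr_eq0 => /eqP ->; rewrite dvdpNr dvdp_mulr.
move=> j; case: (unliftP ord0 j) => [j'|] -> //.
move: E; rewrite H0.1 H0.2 mul0r addr0 add0r => /eqP.
rewrite mulf_eq0 expf_eq0 polyX_eq0 andbF /= => /eqP E.
exact: (IH (fun j => r (lift ord0 j)) (fun j => s (lift ord0 j))).
Qed.

Lemma finite_linear_system (F : fieldType) (U E : finType) (a : U -> E -> F) :
  (#|E| < #|U|)%N ->
  exists2 v : U -> F, (exists u, v u != 0) & forall e, \sum_u v u * a u e = 0.
Proof.
move=> lEU.
pose A : 'M[F]_(#|U|, #|E|) := \matrix_(i, j) a (enum_val i) (enum_val j).
have /rowV0Pn[w /sub_kermxP wA wn0] : kermx A != 0.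
  rewrite kermx_eq0 -row_leq_rank -ltnNge.
  exact: leq_ltn_trans (rank_leq_col A) lEU.
exists (fun u => w 0 (enum_rank u)).
  case/rV0Pn: wn0 => i wi; exists (enum_val i); by rewrite enum_valK.
move=> e; move/rowP/(_ (enum_rank e)): wA; rewrite !mxE => wA.
rewrite -[RHS]wA (reindex _ (onW_bij _ (@enum_val_bij U))) /=.
by apply: eq_bigr => i _; rewrite !mxE enum_valK enum_rankK.
Qed.

(** If the multiplicity [m] of [x] were too small, [('X - x%:P) ^+ m] would divide the derivative of
    [R], which forces [m = 0] in [F]; but [0 < m < p]. *)
Lemma dvdp_exp_derivn (F : fieldType) (p l : nat) x :
  p \in [pchar F] -> (l <= p)%N -> forall R : {poly F},
  (forall k, (k < l)%N -> (R^`(k)).[x] = 0) -> ('X - x%:P) ^+ l %| R.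
Proof.
move=> pch; elim: l => [|l IH] lp R Dk; first by rewrite expr0 dvd1p.
have dR' : ('X - x%:P) ^+ l %| R^`().
  apply: IH; first exact: ltnW.
  by move=> k kl; rewrite -derivSn; apply: Dk.
have [->|Rn0] := eqVneq R 0; first by rewrite dvdp0.
have Rx : R.[x] = 0 by apply: (Dk 0%N).
rewrite -mup_geq // ltnNge; apply/negP => kl.
have [m [q /implyP/(_ Rn0) qx RE]] := multiplicity_XsubC R x.
have mm : mup x R = m.
  rewrite RE mupM ?mup_XsubCX ?eqxx ?mupNroot // ?expf_neq0 ?polyXsubC_eq0 //.
  by apply: contraNneq qx => ->; apply: root0.
have k0 : (0 < mup x R)%N by rewrite -XsubC_dvd // dvdp_XsubCl rootE Rx.
rewrite {}mm in kl k0; case: m k0 RE kl => [//|k] _ RE kl.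
have := dvdp_trans (dvdp_exp2l ('X - x%:P) kl) dR'.
rewrite RE derivM deriv_exp derivXsubC mul1r /= dvdp_addr; last by rewrite dvdp_mull.
rewrite exprS mulrnAr -mulrnAl dvdp_mul2r ?expf_neq0 ?polyXsubC_eq0 //.
rewrite dvdp_XsubCl rootE hornerMn -mulr_natr mulf_eq0.
rewrite -[q.[x] == 0]/(root q x) (negPf qx) /=.
rewrite -(dvdn_pcharf pch) => /(dvdn_leq (ltn0Sn k)); lia.
Qed.

(** What remains of the [k]-th derivative of [f ^+ e * g] once [f ^+ (e - k)] is taken out. Its size
    bound does not involve [e], so high powers of [f] cost no extra conditions. *)
Fixpoint deriv_cofactor (R : comNzRingType) (f g : {poly R}) (e k : nat) : {poly R} :=
  if k is k'.+1 then
    f * (deriv_cofactor f g e k')^`() + (f^`() * deriv_cofactor f g e k') *+ (e - k')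
  else g.

Lemma derivn_deriv_cofactor (R : comNzRingType) (f g : {poly R}) (e k : nat) :
  (k <= e)%N -> (f ^+ e * g)^`(k) = f ^+ (e - k) * deriv_cofactor f g e k.
Proof.
elim: k => [|k IH] ke; first by rewrite subn0 derivn0.
rewrite derivnS IH ?(ltnW ke) // derivM deriv_exp /=.
have -> : (e - k = (e - k.+1).+1)%N by lia.
rewrite /= mulrDr addrC; congr (_ + _); first by rewrite exprSr mulrA.
by rewrite mulrnAl mulrnAr [f^`() * _ ^+ _]mulrC mulrA.
Qed.

Lemma size_deriv_cofactor (R : comNzRingType) (f g : {poly R}) (m d e k : nat) :
  (size f <= m.+1)%N -> (size g <= d)%N -> (size (deriv_cofactor f g e k) <= d + k * m)%N.
Proof.
move=> sf sg; elim: k => [|k IH] /=; first by rewrite addn0.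
have [D0|D0] := leqP (size (deriv_cofactor f g e k)) 0.
  move: D0; rewrite leqn0 size_poly_eq0 => /eqP ->.
  by rewrite deriv0 !mulr0 mul0rn addr0 size_poly0.
have sder (h : {poly R}) n : (size h <= n)%N -> (size h^`() <= n.-1)%N.
  move=> hn'; apply: leq_trans (_ : (size h).-1 <= _)%N; last by lia.
  have [->|hn] := eqVneq h 0; first by rewrite deriv0 size_poly0.
  by have := lt_size_deriv hn; case: (size h) => [|?] //; lia.
apply: (leq_trans (size_polyD _ _)); rewrite geq_max; apply/andP; split.
  apply: (size_polyM_bound sf (sder _ _ IH)).
  by rewrite mulSn; lia.
rewrite -mulr_natr; apply: (@size_polyM_bound _ _ _ (d + k.+1 * m) 1) => //; last by lia.
  apply: (size_polyM_bound (sder _ _ sf) IH).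
  by rewrite mulSn; lia.
by rewrite -polyC_natr size_polyC_leq1.
Qed.

(** In characteristic [p] the derivative of ['X^(p * j)] is 0, so this factor behaves like a
    constant. *)
Lemma deriv_cofactorMX (F : fieldType) (p j : nat) (f g : {poly F}) (e k : nat) :
  p \in [pchar F] ->
  deriv_cofactor f (g * 'X^(p * j)) e k = deriv_cofactor f g e k * 'X^(p * j).
Proof.
move=> pch; elim: k => [//|k IH] /=.
have d0 : ('X^(p * j) : {poly F})^`() = 0.
  by rewrite derivXn -mulr_natr -polyC_natr natrM (pcharf0 pch) mul0r polyC0 mulr0.
by rewrite IH derivM d0 mulr0 addr0 mulrDl !mulrnAl !mulrA.
Qed.

Lemma dvdp_prod_XsubC_exp (F : fieldType) (R : {poly F}) (l : nat) (s : seq F) :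
  uniq s -> (forall x, x \in s -> ('X - x%:P) ^+ l %| R) ->
  (\prod_(x <- s) ('X - x%:P)) ^+ l %| R.
Proof.
elim: s => [|x s IH] /=; first by rewrite big_nil expr1n dvd1p.
case/andP=> xs us H; rewrite big_cons exprMn Gauss_dvdp; last first.
  apply/coprimep_expl/coprimep_expr.
  by rewrite coprimep_sym coprimep_XsubC root_prod_XsubC.
by rewrite H ?mem_head // IH // => y ys; rewrite H // inE ys orbT.
Qed.

(* Stepanov's method for y^2 = f(x): an auxiliary polynomial combining the
   [f ^+ (l + b * c) * 'X^(i + p * j)] vanishes to order [l] on the set. *)
Theorem stepanov_bound (F : finFieldType) (c m lam : nat) (f : {poly F}) (z : F) :
  prime c.*2.+1 -> #|F| = c.*2.+1 -> f.[0] != 0 -> mup z f = 1%N ->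
  (size f <= m.+1)%N -> (lam.*2 * lam.*2 <= c.*2.+1)%N -> (m + 3 <= lam)%N ->
  (lam * #|[set x | (f.[x] == 0) || (f.[x] ^+ c == 1)]%R|.*2
     <= lam * c.*2.+1 + c.*2.+1 * (4 * m + 2))%N.
Proof.
move=> pp cF f0 mf sf lamp mlam.
set S := [set x | _]; set p := c.*2.+1.
have pch := pchar_prime_card pp cF.
(* [l] is the order of vanishing, [D] the largest size that [stepanov_indep] allows, and [J] makes
   the [2 * J * D] unknowns outnumber the [l * (D + l * m + J)] conditions. *)
pose D := ((c.*2.+1 - m)./2)%N; pose l := lam.*2; pose J := (lam + m.*2.+2)%N.
pose U := ('I_J * bool * 'I_D)%type; pose E := ('I_l * 'I_(D + l * m + J))%type.
pose cof (u : U) k := deriv_cofactor f 'X^(u.2) (l + u.1.2 * c) k.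
have Dge : (c.*2 <= D.*2 + m)%N by rewrite /D; lia.
have Dle : (D.*2 + m <= c.*2.+1)%N by rewrite /D; nia.
have cardEU : (#|{: E}| < #|{: U}|)%N.
  rewrite !card_prod !card_ord card_bool /J /l; nia.
have [v [u0 vu0] Hv] := finite_linear_system
  (fun (u : U) (e : E) => (cof u e.1 * 'X^(u.1.1))`_(e.2)) cardEU.
pose R := \sum_u v u *: (f ^+ (l + u.1.2 * c) * ('X^(u.2) * 'X^(p * u.1.1))).
have szcof (u : U) k : (k < l)%N -> (size (cof u k * 'X^(u.1.1))%R <= D + l * m + J)%N.
  move=> kl; case: u => [[j b] i] /=.
  have i1 : (size ('X^i : {poly F}) <= i.+1)%N by rewrite size_polyXn.
  have j1 : (size ('X^j : {poly F}) <= j.+1)%N by rewrite size_polyXn.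
  apply: (size_polyM_bound (size_deriv_cofactor _ _ sf i1) j1).
  have := ltn_ord i; have := ltn_ord j; nia.
have Dk0 k : (k < l)%N -> \sum_u v u *: (cof u k * 'X^(u.1.1)) = 0.
  move=> kl; apply/polyP => n; rewrite coef0 coef_sum.
  have [nb|nb] := ltnP n (D + l * m + J)%N.
    rewrite -[RHS](Hv (Ordinal kl, Ordinal nb)); apply: eq_bigr => u _.
    by rewrite coefZ.
  apply: big1 => u _; rewrite coefZ nth_default ?mulr0 //.
  exact: leq_trans (szcof u k kl) nb.
have RD x : x \in S -> ('X - x%:P) ^+ l %| R.
  rewrite inE => xS; apply: (dvdp_exp_derivn pch).
    by rewrite /l; have : (lam.*2 <= lam.*2 * lam.*2)%N; [nia | lia].
  move=> k kl; rewrite /R (linear_sum (derivn k)) horner_sum.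
  have -> : \sum_u ((v u *: (f ^+ (l + u.1.2 * c) * ('X^(u.2) * 'X^(p * u.1.1))))^`(k)).[x]
      = f.[x] ^+ (l - k) * (\sum_u v u *: (cof u k * 'X^(u.1.1))).[x].
    rewrite horner_sum mulr_sumr; apply: eq_bigr => u _.
    rewrite derivnZ derivn_deriv_cofactor; last lia.
    rewrite (deriv_cofactorMX _ _ _ _ _ pch) -/(cof u k) hornerZ !hornerM.
    rewrite horner_exp hornerZ hornerM !hornerXn.
    have -> : x ^+ (p * u.1.1) = x ^+ u.1.1 by rewrite exprM (_ : x ^+ p = x) // -[RHS]expf_card cF.
    have -> : f.[x] ^+ (l + u.1.2 * c - k) = f.[x] ^+ (l - k).
      have -> : (l + u.1.2 * c - k = (l - k) + c * u.1.2)%N by lia.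
      case/orP: xS => /eqP fx; last by rewrite exprD exprM fx expr1n mulr1.
      by rewrite fx !expr0n; congr (nat_of_bool _)%:R; lia.
    by rewrite mulrCA mulrA.
  by rewrite Dk0 // horner0 mulr0.
have f_n0 : f != 0 by apply: contraNneq f0 => ->; rewrite horner0.
(* If [R] vanished, cancelling [f ^+ l] would leave a relation as in [stepanov_indep], and all
   coefficients [v] would be 0. *)
have Rn0 : R != 0.
  apply: contraNneq vu0 => R0.
  pose r b (j : 'I_J) : {poly F} := \poly_(i < D) (if insub i is Some i' then v (j, b, i') else 0).
  have E0 : \sum_(j < J) (r false j + r true j * f ^+ c) * 'X^(p * j) = 0.
    have RE : R = \sum_j \sum_b \sum_i v (j, b, i) *:
        (f ^+ (l + b * c) * ('X^i * 'X^(p * j))).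
      by rewrite pair_bigA pair_bigA; apply: eq_bigr => -[[j b] i].
    apply: (mulfI (expf_neq0 l f_n0)); rewrite mulr0 mulr_sumr -[RHS]R0 RE.
    apply: eq_bigr => j _; rewrite big_bool /= addrC mulrDl mulrDr.
    have rE b : r b j = \sum_(i < D) v (j, b, i) *: 'X^i.
      rewrite /r poly_def; apply: eq_bigr => i _; rewrite insubT //= => iD.
      by congr (v (_, _, _) *: _); apply: val_inj.
    congr (_ + _); rewrite rE.
      rewrite mulr_suml mulr_sumr; apply: eq_bigr => i _.
      by rewrite mul0n addn0 -scalerAl -scalerAr.
    rewrite !mulr_suml mulr_sumr; apply: eq_bigr => i _.
    rewrite mul1n exprD -!scalerAl -scalerAr; congr (_ *: _); ring.
  have szr b j : (size (r b j) <= D)%N by apply: size_poly.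
  have D0 : (0 < D)%N by rewrite /D; nia.
  have sD : (D.*2 + size f <= c.*2.+2)%N by lia.
  have := stepanov_indep pp cF f0 mf D0 sD (szr false) (szr true) E0.
  case: u0 => [[j b] i] /(_ j) [r0 r1].
  have rb : r b j = 0 by case: b.
  have /polyP/(_ i) := rb; rewrite coef0 coef_poly ltn_ord insubT //= => iD.
  move=> v0; apply/eqP; rewrite -[RHS]v0; congr (v (_, _, _)); exact: val_inj.
have szR : (size R <= (m * (l + c) + D + p * J.-1).+1)%N.
  apply: (leq_trans (size_sum _ _ _)); apply/bigmax_leqP => -[[j b] i] _ /=.
  apply: (leq_trans (size_scale_leq _ _)).
  have i1 : (size ('X^i : {poly F}) <= i.+1)%N by rewrite size_polyXn.
  have j1 : (size ('X^(p * j) : {poly F}) <= (p * j).+1)%N by rewrite size_polyXn.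
  have ij : (size ('X^i * 'X^(p * j) : {poly F})%R <= (i + p * j).+1)%N.
    by apply: (size_polyM_bound i1 j1); lia.
  apply: (size_polyM_bound (size_polyX_bound _ sf) ij).
  have := ltn_ord i; have := ltn_ord j; case: b => /=; nia.
have := dvdp_leq Rn0 (dvdp_prod_XsubC_exp (enum_uniq S)
  (fun x xS => RD x (etrans (esym (mem_enum _ _)) xS))).
have := size_exp (\prod_(x <- enum S) ('X - x%:P)) l.
rewrite size_prod_XsubC -cardE /= => se sl.
have {sl szR se} : (l * #|S| <= m * (l + c) + D + p * J.-1)%N.
  by rewrite mulnC -se -subn1 leq_subLR add1n; exact: leq_trans sl szR.
have lp : (l <= p)%N by rewrite /l; have : (lam.*2 <= lam.*2 * lam.*2)%N; [nia | lia].
have -> : J.-1 = (lam + m.*2.+1)%N by rewrite /J; lia.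
have : (m * (l + c) <= m * p.*2)%N by rewrite leq_mul2l; apply/orP; right; lia.
have : (D <= p)%N by lia.
have -> : (lam * #|S|.*2 = l * #|S|)%N by rewrite /l; lia.
rewrite -!muln2 -[(m * 2).+1]addn1 !mulnDr; lia.
Qed.

(** * Moments of short character sums *)

(** The Legendre symbol, by Euler's criterion, when [#|F| = c.*2.+1]. *)
Definition qchar (F : finFieldType) (c : nat) (x : F) : int :=
  if x ^+ c == 1 then 1 else if x == 0 then 0 else -1.

Section QuadraticCharacter.
Variables (F : finFieldType) (c : nat).
Hypotheses (pp : prime c.*2.+1) (cF : #|F| = c.*2.+1).

Lemma half_card_gt0 : (0 < c)%N.
Proof. by have := prime_gt1 pp; rewrite ltnS double_gt0. Qed.

Lemma oneN1_neq : (1 : F) != -1.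
Proof.
have pch := pchar_prime_card pp cF.
rewrite -subr_eq0 opprK -(natrD F 1 1) addn1 -(dvdn_pcharf pch).
have := half_card_gt0; apply: contraL => /(dvdn_leq (isT : 0 < 2)%N); lia.
Qed.

Lemma expf_half (x : F) : x != 0 -> x ^+ c = 1 \/ x ^+ c = -1.
Proof.
move=> x0; have : (x ^+ c) ^+ 2 == 1.
  rewrite -exprM muln2 -(inj_eq (mulIf x0)) mul1r -exprSr -cF expf_card //.
by rewrite sqrf_eq1 => /orP[] /eqP; [left | right].
Qed.

Lemma qchar0 : qchar c (0 : F) = 0.
Proof.
rewrite /qchar expr0n eqxx; case: (c) half_card_gt0 => //= _ _.
by rewrite eq_sym oner_eq0.
Qed.

Lemma qcharP (x : F) : x != 0 ->
  (x ^+ c = 1 /\ qchar c x = 1) \/ (x ^+ c = -1 /\ qchar c x = -1).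
Proof.
move=> x0; rewrite /qchar (negPf x0); case: (expf_half x0) => ->; first by left; rewrite eqxx.
by right; rewrite eq_sym (negPf oneN1_neq).
Qed.

Lemma qcharM (x y : F) : qchar c (x * y) = qchar c x * qchar c y.
Proof.
have [->|x0] := eqVneq x 0; first by rewrite mul0r qchar0 mul0r.
have [->|y0] := eqVneq y 0; first by rewrite mulr0 qchar0 mulr0.
have xy0 : x * y != 0 by rewrite mulf_neq0.
have NN : ((-1 : F) == 1) = false by rewrite eq_sym; exact: negPf oneN1_neq.
rewrite /qchar (negPf x0) (negPf y0) (negPf xy0) exprMn.
by case: (expf_half x0) (expf_half y0) => -> [] ->;
  rewrite ?mulrNN ?mulr1 ?mul1r ?eqxx ?NN.
Qed.
End QuadraticCharacter.

(** The shifts start at 1 so that 0 is not a root, as Stepanov's condition [f.[0] != 0] demands. *)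
Definition shift_root (F : nzRingType) (H : nat) (h : 'I_H) : F := - (h.+1)%:R.

Section Moment.
Variables (F : finFieldType) (c : nat).
Hypotheses (pp : prime c.*2.+1) (cF : #|F| = c.*2.+1).
Variables (H n : nat).
Hypothesis (Hp : (H < c.*2.+1)%N).


Lemma shift_root_inj : injective (@shift_root F H).
Proof.
have pch := pchar_prime_card pp cF.
have wlog_le (a b : 'I_H) : (a <= b)%N -> shift_root F a = shift_root F b -> a = b.
  move=> ab /oppr_inj /eqP; rewrite eq_sym -subr_eq0 -natrB // -(dvdn_pcharf pch) subSS.
  move=> dv; apply/val_inj/eqP; rewrite eqn_leq ab -subn_eq0 /=.
  by rewrite -leqn0 leqNgt; apply/negP => /dvdn_leq /(_ dv); have := ltn_ord b; lia.
by move=> a b E; case/orP: (leq_total a b) => ab; [|apply/esym]; apply: wlog_le.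
Qed.

Lemma shift_root_neq0 (h : 'I_H) : shift_root F h != 0.
Proof.
rewrite oppr_eq0 -(dvdn_pcharf (pchar_prime_card pp cF)).
by apply/negP => /(dvdn_leq (ltn0Sn h)); have := ltn_ord h; lia.
Qed.

(** Shifts occurring an even number of times contribute squares to the character product; only the
    others enter the squarefree polynomial below. *)
Definition odd_fibres (g : {ffun 'I_n -> 'I_H}) : {set 'I_H} :=
  [set h | odd #|[set i | g i == h]|].

Definition odd_fibres_poly (g : {ffun 'I_n -> 'I_H}) : {poly F} :=
  \prod_(h in odd_fibres g) ('X - (shift_root F h)%:P).

Definition nonneg_points (g : {ffun 'I_n -> 'I_H}) : {set F} :=
  [set x | ((odd_fibres_poly g).[x] == 0) || ((odd_fibres_poly g).[x] ^+ c == 1)].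

(** Away from the roots the product is the character of [odd_fibres_poly g]. At a root it is 0, and
    the last sum, being at least 1, makes up for a possible -1. *)
Lemma qchar_prod_le (g : {ffun 'I_n -> 'I_H}) x :
  \prod_i qchar c (x - shift_root F (g i)) <=
  (if x \in nonneg_points g then 1 else -1) + \sum_i ((x == shift_root F (g i)) : nat)%:Z.
Proof.
have [/existsP[i xi]|] := boolP [exists i, x == shift_root F (g i)].
  rewrite (bigD1 i) //= (eqP xi) subrr qchar0 // mul0r (bigD1 i) //= eqxx.
  rewrite addrA addr_ge0 //; first by case: ifP.
  by apply: sumr_ge0.
rewrite negb_exists => /forallP xg.
rewrite [X in _ <= _ + X]big1 => [|i _]; last by rewrite (negPf (xg i)).
rewrite addr0.
have -> : \prod_i qchar c (x - shift_root F (g i)) = qchar c (odd_fibres_poly g).[x].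
  rewrite /odd_fibres_poly horner_prod.
  have qc1 : qchar c (1 : F) = 1 by rewrite /qchar expr1n eqxx.
  rewrite (big_morph (qchar c) (qcharM pp cF) qc1).
  rewrite (partition_big g xpredT) //= [RHS]big_mkcond /=; apply: eq_bigr => h _.
  rewrite (eq_bigr (fun=> qchar c (x - shift_root F h))) => [|i /eqP -> //].
  rewrite prodr_const hornerXsubC inE.
  have -> : #|[pred i | g i == h]| = #|[set i | g i == h]| by apply: eq_card => i; rewrite !inE.
  set e := #|_|; have [->|e0] := posnP e; first by rewrite expr0.
  have /card_gt0P[i] := e0; rewrite inE => /eqP gi.
  have xh : x - shift_root F h != 0 by rewrite subr_eq0 -gi.
  case: (qcharP pp cF xh) => -[_ ->]; first by rewrite expr1n if_same.
  by rewrite -signr_odd; case: (odd e).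
rewrite inE /qchar; case: eqP => // _; first by rewrite orbT.
by case: eqP.
Qed.

Lemma sum_qchar_prod_le (g : {ffun 'I_n -> 'I_H}) :
  \sum_x \prod_i qchar c (x - shift_root F (g i)) <=
  (#|nonneg_points g|.*2 + n)%:Z - (c.*2.+1)%:Z.
Proof.
apply: (le_trans (ler_sum _ (fun x _ => qchar_prod_le g x))).
rewrite big_split /= exchange_big /=.
rewrite [X in _ + X](eq_bigr (fun=> 1)) => [|i _]; last first.
  by rewrite (bigD1 (shift_root F (g i))) //= eqxx big1 ?addr0 // => x /negPf ->.
rewrite sumr_const card_ord (bigID (mem (nonneg_points g))) /=.
rewrite (eq_bigr (fun=> 1)) => [|x -> //].
rewrite [X in _ + X + _](eq_bigr (fun=> -1)) => [|x /negPf -> //].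
rewrite !sumr_const -[c.*2.+1]cF -(cardC (mem (nonneg_points g))) /=.
set a := #|_|; set b := #|_|; rewrite mulNrn; lia.
Qed.

Variable (lam : nat).
Hypotheses (lamp : (lam.*2 * lam.*2 <= c.*2.+1)%N) (nlam : (n + 3 <= lam)%N).

Lemma nonneg_points_le (g : {ffun 'I_n -> 'I_H}) : odd_fibres g != set0 ->
  (lam * #|nonneg_points g|.*2 <= lam * c.*2.+1 + c.*2.+1 * (4 * n + 2))%N.
Proof.
case/set0Pn => h hB.
have pE : odd_fibres_poly g = \prod_(y <- map (@shift_root F H) (enum (odd_fibres g))) ('X - y%:P).
  by rewrite /odd_fibres_poly big_map big_enum.
apply: (@stepanov_bound F c n lam (odd_fibres_poly g) (shift_root F h)) => //.
- rewrite horner_prod prodf_seq_neq0; apply/allP => i _; apply/implyP => _.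
  by rewrite hornerXsubC sub0r oppr_eq0 shift_root_neq0.
- rewrite pE mu_prod_XsubC count_uniq_mem ?map_inj_uniq ?enum_uniq //; last exact: shift_root_inj.
  by rewrite (mem_map shift_root_inj) mem_enum hB.
rewrite pE size_prod_XsubC size_map -cardE ltnS.
apply: leq_trans (_ : #|g @: 'I_n| <= _)%N; last first.
  by apply: leq_trans (leq_imset_card _ _) _; rewrite card_ord.
apply/subset_leq_card/subsetP => y; rewrite inE => oy.
have /card_gt0P[i] : (0 < #|[set i | g i == y]|)%N by case: #|_| oy.
by rewrite inE => /eqP <-; apply: imset_f.
Qed.
End Moment.

(* If no value is taken an odd number of times, then at most [r] values are taken. *)
Lemma card_even_fibres (H r : nat) :
  (#|[set g : {ffun 'I_(r.*2) -> 'I_H} | odd_fibres g == set0]| <= H ^ r * r ^ r.*2)%N.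
Proof.
case: r => [|r].
  by rewrite /= muln1 expn0; apply: leq_trans (max_card _) _; rewrite card_ffun !card_ord.
have [H0|H0] := posnP H.
  by apply: leq_trans (max_card _) _; rewrite card_ffun !card_ord H0 exp0n.
(* A map [g] with at most [r.+1] values factors through ['I_r.+1]; the bound counts the pairs of
   factors. *)
pose D := ({ffun 'I_r.+1 -> 'I_H} * {ffun 'I_(r.+1.*2) -> 'I_r.+1})%type.
pose comp (d : D) : {ffun 'I_(r.+1.*2) -> 'I_H} := [ffun i => d.1 (d.2 i)].
apply: (@leq_trans #|comp @: [set: D]|); last first.
  by apply: leq_trans (leq_imset_card _ _) _; rewrite cardsT card_prod !card_ffun !card_ord.
apply/subset_leq_card/subsetP => g; rewrite inE => /eqP odd0.
have imr : (#|g @: 'I_(r.+1.*2)| <= r.+1)%N.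
  have : (\sum_(h in g @: 'I_(r.+1.*2)) 2 <= \sum_(h in g @: 'I_(r.+1.*2)) #|[set i | g i == h]|)%N.
    apply: leq_sum => h /imsetP[i _ hi].
    have : h \notin odd_fibres g by rewrite odd0 inE.
    rewrite inE; have : (0 < #|[set i | g i == h]|)%N.
      by apply/card_gt0P; exists i; rewrite inE hi.
    by case: #|_| => [|[|k]].
  rewrite sum_nat_const => le1.
  have : (\sum_(h in g @: 'I_(r.+1.*2)) #|[set i | g i == h]| <= r.+1.*2)%N.
    rewrite -[X in (_ <= X)%N]card_ord -sum1_card (partition_big_imset g) /=.
    apply: eq_leq; apply: eq_bigr => h _; rewrite -sum1_card.
    by apply: eq_bigl => i; rewrite inE.
  by move/(leq_trans le1) => /=; lia.
have h0 : 'I_H := Ordinal H0.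
pose w := [ffun k : 'I_r.+1 => nth h0 (enum (g @: 'I_(r.+1.*2))) k].
pose phi := [ffun i : 'I_(r.+1.*2) => (inord (index (g i) (enum (g @: 'I_(r.+1.*2)))) : 'I_r.+1)].
apply/imsetP; exists (w, phi) => //; apply/ffunP => i; rewrite !ffunE.
have gi : g i \in enum (g @: 'I_(r.+1.*2)) by rewrite mem_enum imset_f.
rewrite inordK ?nth_index //.
by apply: leq_trans imr; rewrite cardE index_mem.
Qed.

Lemma sum_exp_ffun (F : finType) (H n : nat) (a : F -> 'I_H -> int) :
  \sum_x (\sum_h a x h) ^+ n = \sum_(g : {ffun 'I_n -> 'I_H}) \sum_x \prod_i a x (g i).
Proof.
rewrite exchange_big; apply: eq_bigr => x _ /=.
rewrite -(bigA_distr_bigA (fun (_ : 'I_n) h => a x h)) /=.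
by rewrite prodr_const card_ord.
Qed.

(** The summands stem from the trivial bound for even fibres, from Stepanov's error term and from
    the zeros of the products; [4 ^ r] stems from the lower bound [H / 2] on the short sums. *)
Definition moment_const (r Q : nat) : nat :=
  (4 ^ r * (r ^ r.*2 * Q + Q * (16 * r + 4) + r.*2))%N.

(** Markov's inequality for the moment of order [2 * r], expanded over the maps [g]. Since [H ^ r]
    has the size of the square root of [p], the trivial part [H ^ r * p] and Stepanov's part
    [H ^ (2 * r) * sqrt p] balance. *)
Theorem moment_bound (F : finFieldType) (c r H lam Q : nat) (T : {set F}) :
  prime c.*2.+1 -> #|F| = c.*2.+1 -> (H < c.*2.+1)%N ->
  (lam.*2 * lam.*2 <= c.*2.+1)%N -> (r.*2 + 3 <= lam)%N ->
  (c.*2.+1 <= Q * (lam.*2 * lam.*2))%N -> (H ^ r = lam.*2)%N ->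
  (forall x, x \in T -> H%:Z <= (\sum_(h < H) qchar c (x + (h.+1)%:R)) * 2) ->
  (#|T| <= moment_const r Q * lam.*2)%N.
Proof.
move=> pp cF Hp lamp nlam pQ Hr TH.
set p := c.*2.+1; set n := r.*2.
have H0 : (0 < H ^ n)%N.
  rewrite /n -muln2 expnM expn_gt0; apply/orP; left; rewrite Hr; lia.
pose W := ((Q * (16 * r + 4) + r.*2) * lam.*2)%N.
have W_bound (g : {ffun 'I_n -> 'I_H}) : odd_fibres g != set0 ->
    \sum_x \prod_i qchar c (x + ((g i).+1)%:R : F) <= W%:Z.
  move=> odd0; 
  rewrite (eq_bigr (fun x => \prod_i qchar c (x - shift_root F (g i)))); last first.
    by move=> x _; apply: eq_bigr => i _; rewrite opprK.
  apply: (le_trans (sum_qchar_prod_le pp cF Hp g)).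
  have := nonneg_points_le pp cF Hp lamp nlam odd0.
  rewrite -/p; move: #|_| => S leS.
  suff : (S.*2 + n <= W + p)%N by lia.
  have : (lam * S.*2 <= lam * (p + Q * lam.*2 * 2 * (4 * n + 2)))%N.
    apply: leq_trans leS _; rewrite [X in (_ <= X)%N]mulnDr leq_add2l.
    apply: leq_trans (leq_mul pQ (leqnn (4 * n + 2))) _; nia.
  rewrite leq_pmul2l; last lia.
  rewrite /W /n; nia.
have prod_le1 (x : F) (g : {ffun 'I_n -> 'I_H}) : \prod_i qchar c (x + ((g i).+1)%:R : F) <= 1.
  apply: le_trans (ler_norm _) _; rewrite normr_prod.
  apply: prodr_ile1 => i _; rewrite normr_ge0 /= /qchar.
  by case: eqP => _; rewrite ?normr1 //; case: eqP; rewrite ?normr0 ?normrN1.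
have upper : \sum_(x : F) (\sum_(h < H) qchar c (x + (h.+1)%:R)) ^+ n <=
    (H ^ r * r ^ n * p)%:Z + (H ^ n * W)%:Z.
  rewrite sum_exp_ffun (bigID (fun g => odd_fibres g == set0)) /=; apply: lerD.
    apply: le_trans (_ : \sum_(g : {ffun 'I_n -> 'I_H} | odd_fibres g == set0) p%:Z <= _).
      apply: ler_sum => g _; apply: le_trans (ler_sum _ (fun x _ => prod_le1 x g)) _.
      by rewrite sumr_const cF natz.
    rewrite sumr_const -[_ *+ _]mulr_natr natz -PoszM lez_nat mulnC leq_mul2r.
    by apply/orP; right; rewrite -cardsE; exact: card_even_fibres.
  apply: le_trans (ler_sum _ (fun g og => W_bound g og)) _.
  rewrite sumr_const -[_ *+ _]mulr_natr natz -PoszM lez_nat mulnC leq_mul2r.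
  apply/orP; right; apply: leq_trans (max_card _) _.
  by rewrite card_ffun !card_ord.
have even_n (a : int) : 0 <= a ^+ n by rewrite /n -mul2n exprM exprn_ge0 // sqr_ge0.
have lower : (#|T| * H ^ n)%:Z <=
    (2 ^ n)%:Z * \sum_(x : F) (\sum_(h < H) qchar c (x + (h.+1)%:R)) ^+ n.
  rewrite mulr_sumr (bigID (mem T)) /= -[X in X <= _]addr0 lerD //; last first.
    by apply: sumr_ge0 => x _; rewrite mulr_ge0.
  rewrite PoszM mulrC -[#|T|%:Z]natz mulr_natr -sumr_const; apply: ler_sum => x xT.
  have PoszX (k : nat) : (k ^ n)%:Z = k%:Z ^+ n by rewrite -[LHS]natz natrX natz.
  by rewrite !PoszX -exprMn lerXn2r ?nnegrE // mulrC ?TH // (le_trans _ (TH x xT)).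
have [n2 pos2] : (2 ^ n = 4 ^ r)%N /\ 0 <= (2 ^ n)%:Z by rewrite /n -mul2n expnM.
have := le_trans lower (ler_wpM2l pos2 upper).
rewrite -PoszD -PoszM lez_nat n2 => le.
rewrite -(leq_pmul2r H0); apply: leq_trans le _.
have Hn : (H ^ n = lam.*2 * H ^ r)%N by rewrite /n -addnn expnD Hr.
rewrite /moment_const /W -!mulnA leq_pmul2l ?expn_gt0 //.
have : (H ^ r * (r ^ n * p) <= H ^ r * (r ^ n * (Q * (lam.*2 * lam.*2))))%N.
  by rewrite leq_mul2l leq_mul2l pQ !orbT.
rewrite Hn Hr -/n => le1; rewrite !mulnDl; apply: leq_trans (leq_add le1 (leqnn _)) _.
apply: eq_leq; ring.
Qed.

(** * The least quadratic nonresidue *)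

Local Open Scope nat_scope.

(** * Chebyshev's bound and integers with a large prime factor *)

Lemma prod_primes_dvdn (s : seq nat) (m : nat) :
  uniq s -> {in s, forall l, prime l /\ l %| m} -> \prod_(l <- s) l %| m.
Proof.
elim: s => [|l s IH] /=; first by rewrite big_nil dvd1n.
case/andP=> ls us H; have [pl dl] := H l (mem_head _ _).
have Hs : {in s, forall k, prime k /\ k %| m} by move=> k ks; apply: H; rewrite inE ks orbT.
rewrite big_cons Gauss_dvd ?dl ?IH // prime_coprime // Euclid_dvd_prod //.
apply/negP; rewrite big_has => /hasP[k ks]; have [pk _] := Hs k ks.
by rewrite dvdn_prime2 // => /eqP lk; rewrite lk ks in ls.
Qed.

Lemma expn_size_leq_prod (a : nat) (s : seq nat) :
  {in s, forall l, a <= l} -> a ^ size s <= \prod_(l <- s) l.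
Proof.
elim: s => [|l s IH] Hs; first by rewrite big_nil.
rewrite big_cons expnS leq_mul ?IH ?Hs ?mem_head // => k ks.
by apply: Hs; rewrite inE ks orbT.
Qed.

Lemma bin_leq_expn2 (n k : nat) : 'C(n, k) <= 2 ^ n.
Proof.
rewrite -{1}[n]card_ord -card_draws; apply: leq_trans (max_card _) _.
by rewrite -cardsT -powersetT card_powerset cardsT card_ord.
Qed.

Lemma prime_dvd_bin_middle (n l : nat) : prime l -> n < l <= n.*2 -> l %| 'C(n.*2, n).
Proof.
move=> pl /andP[nl ln].
have lfact k : k < l -> (l %| k`!) = false.
  elim: k => [|k IH] kl; first by rewrite fact0 Euclid_dvd1.
  rewrite factS Euclid_dvdM // IH ?(ltnW kl) // orbF.
  by apply/negP => /(dvdn_leq (ltn0Sn k)); lia.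
have : l %| (n.*2)`! by apply: dvdn_fact; lia.
rewrite -(bin_fact (n := n.*2) (m := n)); last lia.
rewrite -{2}addnn addnK !Euclid_dvdM // lfact //.
by rewrite !orbF.
Qed.

(** The product of these primes divides the central binomial coefficient of [2 ^ i.+1] over [2 ^ i],
    and each of them exceeds [2 ^ i]. *)
Lemma dyadic_primes_bound (i : nat) :
  i * \sum_((2 ^ i).+1 <= l < (2 ^ i.+1).+1 | prime l) 1 <= 2 ^ i.+1.
Proof.
rewrite -(leq_exp2l _ _ (ltnSn 1)) expnM.
apply: leq_trans (_ : \prod_((2 ^ i).+1 <= l < (2 ^ i.+1).+1 | prime l) l <= _).
  rewrite sum1_count -big_filter -size_filter; apply: expn_size_leq_prod => l.
  by rewrite mem_filter mem_index_iota => /andP[_ /andP[/ltnW]].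
have dv : \prod_((2 ^ i).+1 <= l < (2 ^ i.+1).+1 | prime l) l %| 'C((2 ^ i).*2, 2 ^ i).
  rewrite -big_filter; apply: prod_primes_dvdn; first by rewrite filter_uniq ?iota_uniq.
  move=> l; rewrite mem_filter mem_index_iota => /andP[pl ll]; split=> //.
  by apply: prime_dvd_bin_middle; rewrite // -mul2n -expnS.
apply: leq_trans (dvdn_leq _ dv) _; first by rewrite bin_gt0; lia.
by rewrite expnS mul2n bin_leq_expn2.
Qed.

(** Each dyadic block of primes contributes at most [2 * X / k]. This is a crude form of Mertens'
    theorem, of use when [j] is small compared with [k]. *)
Lemma dyadic_primes_sum_bound (X k j : nat) :
  k * \sum_((2 ^ k).+1 <= l < (2 ^ (k + j)).+1 | prime l) X %/ l <= j * X.*2.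
Proof.
elim: j => [|j IH]; first by rewrite addn0 big_geq // muln0.
rewrite (big_cat_nat _ (n := (2 ^ (k + j)).+1)) ?ltnS ?leq_exp2l ?leq_addr ?leq_add2l //=.
rewrite mulnDr mulSn addnC leq_add //; set i := k + j; rewrite addnS -/i.
apply: leq_trans (_ : k *
   ((\sum_((2 ^ i).+1 <= l < (2 ^ i.+1).+1 | prime l) 1) * (X %/ 2 ^ i)) <= _).
  rewrite leq_mul2l; apply/orP; right; rewrite big_distrl /= big_nat_cond [leqRHS]big_nat_cond.
  apply: leq_sum => l /andP[/andP[il _] _]; rewrite mul1n.
  by apply: leq_div2l; rewrite ?expn_gt0 // ltnW.
rewrite mulnA; apply: leq_trans (_ : 2 ^ i.+1 * (X %/ 2 ^ i) <= _).
  rewrite leq_mul2r; apply/orP; right; apply: leq_trans (dyadic_primes_bound i).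
  by rewrite leq_mul2r leq_addr orbT.
by rewrite expnS -mulnA mul2n leq_double mulnC leq_trunc_div.
Qed.

(** Each [n] counted is a multiple of the prime [max_pdiv n], so the count is at most the sum of
    [X %/ l] over the primes [l] between [2 ^ k] and [X = 2 ^ (k + j)]. *)
Lemma rough_numbers_bound (k j : nat) :
  k * \sum_(1 <= n < (2 ^ (k + j)).+1) (2 ^ k < max_pdiv n) <= j * (2 ^ (k + j)).*2.
Proof.
apply: leq_trans (dyadic_primes_sum_bound (2 ^ (k + j)) k j).
rewrite leq_mul2l; apply/orP; right.
under [leqRHS]eq_bigr => l _ do rewrite divn_count_dvd.
rewrite exchange_big /= big_nat_cond [leqRHS]big_nat_cond.
apply: leq_sum => n /andP[/andP[n0 nX] _].
case: ltnP => //= kn.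
have n1 : 1 < n.
  rewrite ltn_neqAle n0 andbT eq_sym; apply: contraTneq kn => ->.
  by rewrite -leqNgt (_ : max_pdiv 1 = 1) // expn_gt0.
rewrite big_mkcond (bigD1_seq (max_pdiv n)) ?iota_uniq //=; last first.
  by rewrite mem_index_iota kn /=; apply: leq_ltn_trans nX; apply/dvdn_leq/max_pdiv_dvd.
by rewrite max_pdiv_prime // max_pdiv_dvd.
Qed.

(** Cleared of denominators, this bounds the sum of [1 / d ^ 2] by the telescoping [1/4 + 1/(2 * 3)
    + ... + 1/((m - 1) * m) = 3/4 - 1/m]. *)
Lemma noncoprime_pairs_aux (N V m : nat) : 1 < m ->
  m * (4 * \sum_(2 <= d < m.+1) (N %/ d) * (V %/ d)) <= N * V * (3 * m - 4).
Proof.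
elim: m => // m IH; rewrite ltnS leq_eqVlt => /orP[/eqP <-|m1].
  by rewrite big_nat1; have := leq_trunc_div N 2; have := leq_trunc_div V 2; nia.
rewrite big_nat_recr ?(leqW m1) //=; move: (IH m1); set S := \sum_(_ <= _ < _) _ => {}IH.
set x := N %/ m.+1 * (V %/ m.+1).
have xle : x * m.+1 * m.+1 <= N * V.
  have -> : x * m.+1 * m.+1 = (N %/ m.+1 * m.+1) * (V %/ m.+1 * m.+1) by rewrite /x; ring.
  by rewrite leq_mul ?leq_trunc_div.
rewrite -(leq_pmul2l (ltnW m1)).
have -> : m * (m.+1 * (4 * (S + x))) = m.+1 * (m * (4 * S)) + 4 * (m * (x * m.+1)) by lia.
apply: leq_trans (_ : m.+1 * (N * V * (3 * m - 4)) + 4 * (N * V) <= _); last first.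
  have E : m.+1 * (3 * m - 4) + 4 = m * (3 * m.+1 - 4).
    by move: m1; case: m {IH S x xle} => [|[|m]] // _; nia.
  by rewrite [leqRHS]mulnCA -E; apply: eq_leq; ring.
apply: leq_add; first by rewrite leq_mul2l IH orbT.
by rewrite leq_mul2l; apply: leq_trans xle; rewrite mulnC leq_mul2l leqnSn orbT.
Qed.

Lemma card_dvdn_succ (N d : nat) : #|[set u : 'I_N | d %| u.+1]| = N %/ d.
Proof.
rewrite divn_count_dvd big_add1 /= big_mkord -sum1_card big_mkcond /=.
by apply: eq_bigr => u _; rewrite inE; case: (d %| _).
Qed.

(** Union bound over the values [d >= 2] of a common divisor; a pair that is not coprime is caught
    by its gcd. *)
Lemma noncoprime_pairs_bound (N V : nat) :
  4 * #|[set uv : 'I_N * 'I_V | ~~ coprime uv.1.+1 uv.2.+1]| <= 3 * (N * V).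
Proof.
have [V1|V1] := leqP V 1.
  rewrite (_ : #|_| = 0) //; apply: eq_card0 => -[u v]; rewrite !inE /=.
  have v1 : v.+1 = 1 by have := ltn_ord v; lia.
  by rewrite v1 coprimen1.
apply: leq_trans (_ : 4 * \sum_(2 <= d < V.+1) (N %/ d) * (V %/ d) <= _).
  rewrite leq_mul2l /=.
  apply: leq_trans (_ : \sum_(2 <= d < V.+1)
     #|setX [set u : 'I_N | d %| u.+1] [set v : 'I_V | d %| v.+1]| <= _); last first.
    by apply: leq_sum => d _; rewrite cardsX !card_dvdn_succ.
  have -> : \sum_(2 <= d < V.+1) #|setX [set u : 'I_N | d %| u.+1] [set v : 'I_V | d %| v.+1]|
     = \sum_(uv : 'I_N * 'I_V) \sum_(2 <= d < V.+1) ((d %| uv.1.+1) && (d %| uv.2.+1)).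
    rewrite exchange_big /=; apply: eq_bigr => d _.
    rewrite -sum1_card big_mkcond; apply: eq_bigr => uv _.
    by rewrite !inE; case: (_ && _).
  rewrite -sum1_card big_mkcond; apply: leq_sum => -[u v] _; rewrite inE /=.
  case: ifP => // ncop; set d := gcdn u.+1 v.+1.
  have d2 : 1 < d by rewrite ltn_neqAle gcdn_gt0 andbT eq_sym; exact: ncop.
  rewrite (bigD1_seq d) ?iota_uniq //=; first by rewrite dvdn_gcdl dvdn_gcdr.
  rewrite mem_index_iota d2 /= ltnS; apply: leq_trans (ltn_ord v).
  by apply: dvdn_leq; rewrite ?dvdn_gcdr.
have := @noncoprime_pairs_aux N V V V1; set S := \sum_(_ <= _ < _) _ => le.
rewrite -(leq_pmul2l (ltnW V1)); apply: leq_trans le _.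
by rewrite [leqRHS]mulnCA mulnC [leqRHS]mulnA leq_mul2r; apply/orP; right; lia.
Qed.

(** * Burgess's argument for the least nonresidue *)

Section SmallNonresidue.
Variables (F : finFieldType) (c : nat).
Hypotheses (pp : prime c.*2.+1) (cF : #|F| = c.*2.+1).

Lemma natf_small_neq0 (n : nat) : 0 < n < c.*2.+1 -> (n%:R != 0 :> F)%R.
Proof.
move=> /andP[n0 np]; rewrite -(dvdn_pcharf (pchar_prime_card pp cF)).
by apply/negP => /(dvdn_leq n0); rewrite leqNgt np.
Qed.

Lemma qchar1 : qchar c (1 : F)%R = 1%R.
Proof. by rewrite /qchar expr1n eqxx. Qed.

(** By multiplicativity, removing a least prime factor that is a residue leaves a smaller
    nonresidue. *)
Lemma nonresidue_prime_factor (n : nat) :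
  0 < n < c.*2.+1 -> qchar c (n%:R : F)%R = (-1)%R ->
  exists l, [/\ prime l, l %| n & qchar c (l%:R : F)%R = (-1)%R].
Proof.
have [k] := ubnP n; elim: k n => // k IH n nk /andP[n0 np] nchi.
have [n1|n1] := leqP n 1.
  have n1' : n = 1 by lia.
  by move: nchi; rewrite n1' qchar1.
have pl := pdiv_prime n1; have dl := pdiv_dvd n.
have l0 : 0 < pdiv n < c.*2.+1.
  by rewrite prime_gt0 //=; apply: leq_ltn_trans np; apply: dvdn_leq.
case: (qcharP pp cF (natf_small_neq0 l0)) => -[_ chil]; last by exists (pdiv n).
have nE : n = n %/ pdiv n * pdiv n by rewrite divnK.
have m0 : 0 < n %/ pdiv n by rewrite divn_gt0 ?prime_gt0 // dvdn_leq.
have mn : n %/ pdiv n < n by rewrite ltn_Pdiv // prime_gt1.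
have [||l [pl' dl' chil']] := IH (n %/ pdiv n) (leq_trans mn nk).
- by rewrite m0 (ltn_trans mn).
- by move: nchi; rewrite {1}nE natrM (qcharM pp cF) chil mulr1.
by exists l; split=> //; apply: dvdn_trans dl' _; rewrite {3}nE dvdn_mulr.
Qed.

Variables (k : nat).
Hypothesis (small_res : forall n, 0 < n <= 2 ^ k -> qchar c (n%:R : F)%R <> (-1)%R).

Definition is_nonres (n : nat) : bool := qchar c (n%:R : F)%R == (-1)%R.

Lemma nonres_count_bound (j : nat) : 2 ^ (k + j) < c.*2.+1 ->
  k * \sum_(1 <= n < (2 ^ (k + j)).+1) is_nonres n <= j * (2 ^ (k + j)).*2.
Proof.
move=> Xp; apply: leq_trans (rough_numbers_bound k j).
rewrite leq_mul2l; apply/orP; right.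
rewrite big_nat_cond [leqRHS]big_nat_cond; apply: leq_sum => n /andP[/andP[n0 nX] _].
case: (boolP (is_nonres n)) => //= /eqP nchi.
have [|l [pl dl chil]] := nonresidue_prime_factor _ nchi.
  by rewrite n0; apply: leq_trans Xp.
have kl : 2 ^ k < l.
  by rewrite ltnNge; apply/negP => lk; apply: (small_res _ chil); rewrite lk prime_gt0.
by rewrite lt0b; apply: leq_trans kl (max_pdiv_max _); rewrite mem_primes pl n0.
Qed.

(** Markov's inequality: for fixed [v] and [h] the numbers [u + h * v] are distinct and at most [B],
    so they meet each nonresidue at most once. *)
Lemma card_bad_pairs (N V H B : nat) :
  0 < H -> N + H * V <= B ->
  #|[set uv : 'I_N * 'I_V | H <= 4 * \sum_(h < H) is_nonres (uv.1.+1 + h.+1 * uv.2.+1)]|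
   <= 4 * V * \sum_(1 <= n < B.+1) is_nonres n.
Proof.
move=> H0 NB; set bad := [set _ | _].
rewrite -(leq_pmul2r H0).
apply: leq_trans (_ : \sum_(uv : 'I_N * 'I_V)
   4 * \sum_(h < H) is_nonres (uv.1.+1 + h.+1 * uv.2.+1) <= _).
  rewrite -sum_nat_const big_mkcond; apply: leq_sum => uv _.
  by rewrite inE; case: ifP.
rewrite -big_distrr /= -!mulnA leq_mul2l /= [V * _]mulnC -mulnA.
rewrite -(pair_bigA _ (fun (u : 'I_N) (v : 'I_V) =>
   \sum_(h < H) is_nonres (u.+1 + h.+1 * v.+1))) /=.
rewrite exchange_big /=.
have le1 v h : (v < V) -> (h < H) ->
    \sum_(u < N) is_nonres (u.+1 + h.+1 * v.+1) <= \sum_(1 <= n < B.+1) is_nonres n.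
  move=> vV hH; set m := h.+1 * v.+1.
  have mB : N + m <= B by apply: leq_trans NB; rewrite leq_add2l leq_mul.
  rewrite [leqRHS](big_cat_nat _ (n := m.+1)) //=; last by lia.
  rewrite [X in _ <= _ + X](big_cat_nat _ (n := (N + m).+1)) //=; try lia.
  rewrite addnCA; apply: leq_trans (leq_addr _ _).
  rewrite -[X in \sum_(X <= _ < _) _]add0n big_addn subSS addnK big_mkord.
  by apply: leq_sum => u _; rewrite addnS.
apply: leq_trans (_ : \sum_(v < V) \sum_(h < H) \sum_(1 <= n < B.+1) is_nonres n <= _).
  by apply: leq_sum => v _; rewrite exchange_big; apply: leq_sum => h _; apply: le1.
by rewrite !sum_nat_const !card_ord mulnA [leqRHS]mulnC [H * V]mulnC.
Qed.

Lemma natf_small_inj (m n : nat) : m < c.*2.+1 -> n < c.*2.+1 -> (m%:R = n%:R :> F)%R -> m = n.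
Proof.
have wlog_le m' n' : m' <= n' -> n' < c.*2.+1 -> (m'%:R = n'%:R :> F)%R -> m' = n'.
  move=> mn np E; have [|lt0] := posnP (n' - m'); first by move/eqP; lia.
  have /eqP[] : ((n' - m')%:R != 0 :> F)%R by apply: natf_small_neq0; lia.
  by rewrite natrB // E subrr.
move=> mp np E; case/orP: (leq_total m n) => mn; first exact: wlog_le E.
by apply/esym/wlog_le.
Qed.

Lemma is_nonres_qchar (n : nat) : 0 < n < c.*2.+1 ->
  (qchar c (n%:R : F) = 1 - ((is_nonres n)%:Z) * 2)%R.
Proof.
by move=> np; rewrite /is_nonres; case: (qcharP pp cF (natf_small_neq0 np)) => -[_ ->].
Qed.

(** This turns the character of [u / v + h] into that of the small integer [u + h * v]. *)
Lemma qchar_div_small (y : F) (v : nat) : 0 < v <= 2 ^ k -> v < c.*2.+1 ->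
  qchar c (y / v%:R)%R = qchar c y.
Proof.
move=> vk vp; have v0 : 0 < v < c.*2.+1 by rewrite vp andbT; case/andP: vk.
have vn := natf_small_neq0 v0.
have v1 : qchar c (v%:R : F)%R = 1%R.
  by case: (qcharP pp cF vn) => -[_] // vchi; case: (small_res vk vchi).
by have := qcharM pp cF (y / v%:R)%R v%:R%R; rewrite divfK // v1 mulr1.
Qed.

Definition good_fractions (N V H : nat) : {set 'I_N * 'I_V} :=
  [set uv : 'I_N * 'I_V | coprime uv.1.+1 uv.2.+1 &&
    (4 * \sum_(h < H) is_nonres (uv.1.+1 + h.+1 * uv.2.+1) < H)].

(** At most one pair in eight is bad by [card_bad_pairs], and at most three in four fail to be
    coprime, which leaves one in eight. *)
Lemma card_good_fractions (N V H B : nat) :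
  0 < H -> N + H * V <= B ->
  32 * V * \sum_(1 <= n < B.+1) is_nonres n <= N * V ->
  N * V <= 8 * #|good_fractions N V H|.
Proof.
move=> H0 NB small.
have bad := card_bad_pairs H0 NB; have ncop := noncoprime_pairs_bound N V.
set S1 := [set _ | _] in bad; set S2 := [set _ | _] in ncop.
have : N * V <= #|good_fractions N V H :|: S1 :|: S2|.
  have <- : #|[set: 'I_N * 'I_V]| = N * V by rewrite cardsT card_prod !card_ord.
  apply/subset_leq_card/subsetP => uv _; rewrite !inE.
  by rewrite ltnNge; case: coprime; case: (H <= _).
move/leq_trans/(_ (leq_card_setU _ _).1).
move/leq_trans/(_ (leq_add (leq_card_setU _ _).1 (leqnn _))).
move: bad ncop small; rewrite -!mulnA; set x := V * _.
move: #|S1| #|S2| #|good_fractions N V H| x (N * V) => s1 s2 g x NV; lia.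
Qed.

Definition fraction (N V : nat) (uv : 'I_N * 'I_V) : F := (uv.1.+1%:R / uv.2.+1%:R)%R.

(** Equal fractions satisfy [u * v' = u' * v] in [F], hence in the integers, because both sides are
    at most [N * V]; being in lowest terms, they coincide. *)
Lemma fraction_inj (N V H : nat) : N * V < c.*2.+1 -> 
  {in good_fractions N V H &, injective (@fraction N V)}.
Proof.
move=> NVp; move=> [u v] [u' v']; rewrite !inE /= => /andP[cuv _] /andP[cuv' _].
rewrite /fraction /= => /eqP.
have uN := ltn_ord u; have vV := ltn_ord v; have uN' := ltn_ord u'; have vV' := ltn_ord v'.
have vp w : w < V -> 0 < w.+1 < c.*2.+1.
  move=> wV /=; apply: leq_ltn_trans NVp; apply: leq_trans wV _.
  by rewrite leq_pmull //; apply: leq_ltn_trans uN.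
rewrite eqr_div ?natf_small_neq0 ?vp // -!natrM => /eqP E.
have {}E : u.+1 * v'.+1 = u'.+1 * v.+1.
  by apply: natf_small_inj E; apply: leq_ltn_trans NVp; apply: leq_mul.
have uu : u.+1 = u'.+1.
  apply/eqP; rewrite eqn_dvd -(Gauss_dvdl _ cuv) -E dvdn_mulr //=.
  by rewrite -(Gauss_dvdl _ cuv') E dvdn_mulr.
have vv : v.+1 = v'.+1 by apply/eqP; rewrite eq_sym -(eqn_pmul2l (ltn0Sn u)) E uu.
by congr (_, _); apply/val_inj/eqP; rewrite -eqSS ?uu ?vv.
Qed.

(** Fewer than [H / 4] of the values are -1 and the others are 1, so the sum exceeds [H / 2]. *)
Lemma fraction_qchar_sum (N V H : nat) (uv : 'I_N * 'I_V) :
  V <= 2 ^ k -> N + H * V < c.*2.+1 -> uv \in good_fractions N V H ->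
  (H%:Z <= (\sum_(h < H) qchar c (fraction uv + (h.+1)%:R)) * 2)%R.
Proof.
case: uv => u v Vk NHp; rewrite inE /fraction /= => /andP[_ small].
have uN := ltn_ord u; have vV := ltn_ord v.
have [H0|H0] := posnP H; first by move: small; rewrite H0.
have V_le : V <= H * V by rewrite leq_pmull.
have vk : 0 < v.+1 <= 2 ^ k by rewrite (leq_trans vV Vk).
have vp : v.+1 < c.*2.+1 by lia.
have vn : (v.+1%:R != 0 :> F)%R by apply: natf_small_neq0; lia.
rewrite (eq_bigr (fun h : 'I_H => 1 - (is_nonres (u.+1 + h.+1 * v.+1))%:Z * 2)%R); last first.
  move=> h _; have hv : h.+1 * v.+1 <= H * V by apply: leq_mul.
  rewrite -is_nonres_qchar; last lia.
  rewrite -[RHS](qchar_div_small _ vk vp) natrD natrM mulrDl mulfK //.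
rewrite sumrB sumr_const card_ord -mulr_suml -natz.
move: small; rewrite -(ltr_nat int) natrM natr_sum.
under eq_bigr => h _ do rewrite natz.
set S := (\sum_(_ < _) _)%R; rewrite !natz; lia.
Qed.
End SmallNonresidue.

Theorem small_nonresidue (F : finFieldType) (c a s : nat) :
  prime c.*2.+1 -> #|F| = c.*2.+1 -> 512 <= a ->
  8 * moment_const a.*2.+2 (2 ^ (4 * a + 4)) < 2 ^ s ->
  2 ^ (s * (4 * a + 4)) <= c.*2.+1 <= 2 ^ (s.+1 * (4 * a + 4)) ->
  exists2 n, 0 < n <= 2 ^ (s * a) & qchar c (n%:R : F)%R = (-1)%R.
Proof.
move=> pp cF a512; set r := a.*2.+2; set Q := 2 ^ _; set mc := moment_const r Q => mcs.
move=> /andP[tp pQ].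
have [/existsP[n /andP[n0 /eqP chin]]|none] :=
    boolP [exists n : 'I_(2 ^ (s * a)).+1, (0 < n) && (qchar c (n%:R : F) == -1)%R].
  by exists n => //; rewrite n0 -ltnS ltn_ord.
exfalso; pose k := s * a; pose j := s * 3 + 1.
have small_res n : 0 < n <= 2 ^ k -> qchar c (n%:R : F)%R <> (-1)%R.
  move=> /andP[n0 nk] chin; case/negP: none; apply/existsP.
  have nk' : n < (2 ^ (s * a)).+1 by [].
  by exists (Ordinal nk'); rewrite /= n0 chin eqxx.
have mcr : 16 * r + 4 <= mc.
  rewrite /mc /moment_const; apply: leq_trans (leq_pmull _ _); last by rewrite expn_gt0.
  rewrite -addnA addnCA; apply: leq_trans (leq_addr _ _).
  by apply: leq_pmull; rewrite expn_gt0.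
have s0 : 0 < s by case: (s) mcs => //; lia.
have two_expn x y : x < y -> 2 ^ x < 2 ^ y by move=> xy; rewrite ltn_exp2l.
(* With [t = 2 ^ s]: [N = t ^ (a + 3)], [V = t ^ a], [H = t] and [lam.*2 = t ^ (2 * a + 2)]. Thus
   [N * V] is [t] times [lam.*2], too much for the moment bound, yet below [p]; and [H * V <= N]
   keeps each [u + h * v] within [2 * N]. *)
pose N := 2 ^ (s * (a + 3)); pose V := 2 ^ k; pose H := 2 ^ s.
pose lam := 2 ^ (s * r).-1.
have lamE : lam.*2 = 2 ^ (s * r).
  by rewrite /lam -mul2n -expnS prednK // muln_gt0 s0.
have BE : 2 ^ (k + j) = N.*2.
  by rewrite /N -mul2n -expnS; congr (2 ^ _); rewrite /k /j; lia.
have Bp : 2 ^ (k + j) < c.*2.+1.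
  by apply: leq_trans tp; apply: two_expn; rewrite /k /j; nia.
have H0 : 0 < H by rewrite expn_gt0.
have HV : N + H * V <= 2 ^ (k + j).
  rewrite BE -addnn leq_add2l /H /V -expnD leq_exp2l //; rewrite /k; nia.
have NVE : N * V = 2 ^ s * lam.*2.
  by rewrite lamE /N /V -!expnD; congr (2 ^ _); rewrite /k /r; lia.
have NVp : N * V < c.*2.+1.
  by apply: leq_trans tp; rewrite /N /V -expnD; apply: two_expn; rewrite /k; nia.
have Hp : H < c.*2.+1 by apply: leq_trans tp; apply: two_expn; nia.
(* The nonresidues up to [2 * N] number at most [4 * N * j / k <= 16 * N / a]; this is where
   [512 <= a] enters. *)
have count32 : 32 * V * \sum_(1 <= n < (2 ^ (k + j)).+1) is_nonres F c n <= N * V.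
  have := nonres_count_bound pp cF small_res Bp; rewrite BE.
  set S := \sum_(_ <= _ < _) _ => le.
  have : s * (a * S) <= s * (16 * N).
    by rewrite mulnA; apply: leq_trans le _; rewrite /j; nia.
  rewrite leq_pmul2l // => {}le.
  have : 512 * S <= 16 * N by apply: leq_trans le; rewrite leq_mul2r a512 orbT.
  by rewrite mulnAC leq_mul2r => le32; apply/orP; right; lia.
have cg := card_good_fractions pp cF H0 HV count32.
pose T : {set F} := @fraction F N V @: good_fractions F c N V H.
have cT : #|T| = #|good_fractions F c N V H|.
  by apply: card_in_imset; exact: (fraction_inj pp cF NVp).
have : #|T| <= mc * lam.*2.
  apply: (moment_bound pp cF Hp).
  - by apply: leq_trans tp; rewrite lamE -expnD leq_exp2l // /r; lia.
  - have : 2 ^ s <= lam.*2 by rewrite lamE leq_exp2l // /r; nia.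
    lia.
  - by rewrite lamE -!expnD; apply: leq_trans pQ _; rewrite leq_exp2l // /r; lia.
  - by rewrite lamE /H -expnM.
  move=> x /imsetP[uv guv ->]; apply: (fraction_qchar_sum pp cF small_res _ _ guv) => //.
  exact: leq_ltn_trans HV Bp.
rewrite cT => /(leq_mul (leqnn 8)) /(leq_trans cg).
rewrite NVE mulnA leq_pmul2r; first by rewrite leqNgt mcs.
by rewrite lamE expn_gt0.
Qed.

Local Open Scope ring_scope.

(** * Exponential sums over sifted sets *)

Section AdditiveFourier.
Variables (F : finFieldType) (e : F -> algC).
Hypotheses (eD : forall x y, e (x + y) = e x * e y) (e0 : e 0 = 1).
Hypotheses (eJ : forall x, (e x)^* = e (- x)) (e1 : e 1 != 1).

Definition expsum (S : {set F}) (a : F) : algC := \sum_(z in S) e (a * z).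

(** Orthogonality: shifting [a] by [b^-1] multiplies the sum by [e 1], which is not 1. *)
Lemma sum_addchar (b : F) : \sum_a e (a * b) = if b == 0 then #|F|%:R else 0.
Proof.
case: eqVneq => [->|b0].
  by rewrite (eq_bigr (fun=> 1)) ?sumr_const // => a _; rewrite mulr0 e0.
set s := \sum_a _; have : s = s * e 1.
  rewrite {1}/s (reindex_inj (addIr b^-1)) /= mulr_suml; apply: eq_bigr => a _.
  by rewrite mulrDl mulVf // eD.
move/eqP; rewrite -subr_eq0 -{1}[s]mulr1 -mulrBr mulf_eq0 subr_eq0 [1 == _]eq_sym.
by rewrite (negPf e1) orbF => /eqP.
Qed.

Lemma expsum_conj (S : {set F}) a : (expsum S a)^* = \sum_(z in S) e (- (a * z)).
Proof. by rewrite rmorph_sum; apply: eq_bigr => z _; rewrite /= eJ. Qed.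

Lemma expsum0 (S : {set F}) : expsum S 0 = #|S|%:R.
Proof.
by rewrite /expsum (eq_bigr (fun=> 1)) ?sumr_const // => z _; rewrite mul0r e0.
Qed.

Lemma expsum_parseval (S : {set F}) :
  \sum_a `|expsum S a| ^+ 2 = (#|F| * #|S|)%:R.
Proof.
have E a : `|expsum S a| ^+ 2 = \sum_(z in S) \sum_(w in S) e (a * (z - w)).
  rewrite normCK expsum_conj mulr_suml; apply: eq_bigr => z _.
  by rewrite mulr_sumr; apply: eq_bigr => w _; rewrite -eD mulrBr.
rewrite (eq_bigr _ (fun a _ => E a)) exchange_big /= natrM mulr_natr -sumr_const.
apply: eq_bigr => z zS; rewrite exchange_big /= (bigD1 z) //= sum_addchar subrr eqxx.
by rewrite big1 ?addr0 // => w /andP[_ wz]; rewrite sum_addchar subr_eq0 eq_sym (negPf wz).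
Qed.

(* [expsum S] is constant on the cosets of [H], so its value at [a] is
   counted [#|H|] times in Parseval's identity. *)
Lemma expsum_invariant_bound (S H : {set F}) (a : F) :
  a != 0 -> 0 \notin H -> (forall w z, w \in H -> z \in S -> w * z \in S) ->
  #|H|%:R * `|expsum S a| ^+ 2 <= (#|F| * #|S|)%:R.
Proof.
move=> a0 H0 HS.
have w0 w : w \in H -> w != 0 by apply: contraTneq => ->.
have inv w : w \in H -> expsum S (a * w) = expsum S a.
  move=> wH; have wS : [set w * z | z in S] = S.
    apply/eqP; rewrite eqEcard card_imset ?leqnn; last exact: mulfI (w0 w wH).
    by rewrite andbT; apply/subsetP => _ /imsetP[z zS ->]; apply: HS.
  rewrite -[in RHS]wS /expsum big_imset /=; last first.
    by move=> x y _ _; exact: (mulfI (w0 w wH)).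
  by apply: eq_bigr => z _; rewrite mulrA.
rewrite -expsum_parseval mulrC mulr_natr -sumr_const.
rewrite (eq_bigr (fun w => `|expsum S (a * w)| ^+ 2)); last by move=> w wH; rewrite inv.
rewrite -(big_imset (h := *%R a) (fun b => `|expsum S b| ^+ 2)) /=; last first.
  by move=> x y _ _; exact: (mulfI a0).
rewrite [leRHS](bigID (mem [set a * w | w in H])) /= lerDl.
by apply: sumr_ge0 => b _; rewrite exprn_ge0.
Qed.

(** If no [x + y] lay in [S], the Fourier count of representations would vanish: its term
    [#|S| * #|X| ^ 2] at [a = 0] would be cancelled by the others, which Parseval bounds by
    [B * #|F| * #|X|]. *)
Lemma exists_sum_in (S X : {set F}) (B : algC) :
  0 <= B -> (forall a, a != 0 -> `|expsum S a| <= B) ->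
  B * #|F|%:R < (#|S| * #|X|)%:R ->
  exists x y, [/\ x \in X, y \in X & x + y \in S].
Proof.
move=> B0 SB lt.
have [/existsP[x /andP[xX /existsP[y /andP[yX xyS]]]]|none] :=
    boolP [exists x, (x \in X) && [exists y, (y \in X) && (x + y \in S)]].
  by exists x, y.
exfalso.
have total : \sum_a expsum S a * (expsum X a)^* ^+ 2 = 0.
  have E a : expsum S a * (expsum X a)^* ^+ 2 =
      \sum_(z in S) \sum_(x in X) \sum_(y in X) e (a * (z - (x + y))).
    rewrite expsum_conj expr2 mulr_suml; apply: eq_bigr => z _.
    rewrite mulr_suml mulr_sumr; apply: eq_bigr => x _.
    rewrite mulr_sumr mulr_sumr; apply: eq_bigr => y _.
    by rewrite -!eD; congr e; ring.
  rewrite (eq_bigr _ (fun a _ => E a)) exchange_big big1 //= => z zS.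
  rewrite exchange_big big1 //= => x xX; rewrite exchange_big big1 //= => y yX.
  rewrite sum_addchar subr_eq0; case: eqP => // zE.
  case/negP: none; apply/existsP; exists x; rewrite xX /=; apply/existsP; exists y.
  by rewrite yX -zE.
have X0 : (0 < #|X|)%N.
  rewrite lt0n; apply/negP => /eqP X0; move: lt; rewrite X0 muln0.
  by move=> /(le_lt_trans (mulr_ge0 B0 (ler0n _ _))); rewrite ltxx.
move: total; rewrite (bigD1 0) //= !expsum0 conjC_nat => /eqP; rewrite addr_eq0 => /eqP total.
have : (#|S| * #|X| ^ 2)%:R <= B * (#|F| * #|X|)%:R.
  rewrite natrM natrX -[leLHS]ger0_norm ?mulr_ge0 ?exprn_ge0 ?ler0n // total normrN.
  rewrite -expsum_parseval mulr_sumr; apply: le_trans (ler_norm_sum _ _ _) _.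
  rewrite [leRHS](bigD1 0) //= -[leLHS]add0r lerD //.
    by rewrite mulr_ge0 // exprn_ge0.
  apply: ler_sum => a a0; rewrite normrM normrX norm_conjC.
  by rewrite ler_wpM2r ?exprn_ge0 // SB.
have XX : 0 < #|X|%:R :> algC by rewrite ltr0n.
move: lt; rewrite -(ltr_pM2r XX) => lt le.
suff : B * #|F|%:R * #|X|%:R < B * #|F|%:R * #|X|%:R by rewrite ltxx.
by apply: lt_le_trans lt _; move: le; rewrite !natrM !mulrA.
Qed.
End AdditiveFourier.

(** * Sifting out the l-th powers *)

Lemma card_exp_fibre (F : finFieldType) (d : nat) (y : F) :
  (0 < d)%N -> (#|[set x : F | x ^+ d == y]| <= d)%N.
Proof.
move=> d0; rewrite cardE -ltnS.
have szP : size ('X^d - y%:P : {poly F}) = d.+1 by rewrite size_XnsubC.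
have P0 : 'X^d - y%:P != 0 :> {poly F} by rewrite -size_poly_gt0 szP.
rewrite -szP; apply: max_poly_roots P0 _ (enum_uniq _).
apply/allP => x; rewrite mem_enum inE => /eqP xd.
by rewrite rootE hornerD hornerN hornerC hornerXn xd subrr.
Qed.

Lemma coprime_exp_eq1 (F : fieldType) (x : F) (i j : nat) :
  coprime i j -> x ^+ i = 1 -> x ^+ j = 1 -> x = 1.
Proof.
have [->|i0] := posnP i.
  by rewrite /coprime gcd0n => /eqP -> _; rewrite expr1.
move=> /(coprimeP _ i0)[[u v] /= uv] xi xj.
have uE : (u * i = v * j + 1)%N by lia.
have : x ^+ (u * i) = x ^+ (v * j + 1) by rewrite uE.
by rewrite exprD [(u * i)%N]mulnC [(v * j)%N]mulnC !exprM xi xj !expr1n mul1r.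
Qed.

Section Sifting.
Variables (F : finFieldType) (n : nat).
Hypotheses (n0 : (0 < n)%N) (cF : #|F| = n.+1).

Lemma card_unity_roots (d : nat) :
  (d %| n)%N -> (n %/ d <= #|[set w : F | w ^+ (n %/ d) == 1]%R|)%N.
Proof.
move=> dn; have d0 : (0 < d)%N by apply: dvdn_gt0 dn.
pose Y := [set x ^+ d | x in [set~ (0 : F)]].
apply: (@leq_trans #|Y|).
  rewrite -(leq_pmul2r d0) divnK //.
  have -> : n = #|[set~ (0 : F)]| by rewrite cardsC1 cF.
  rewrite -sum1_card (partition_big_imset (fun x => x ^+ d)) /= -sum_nat_const.
  apply: leq_sum => y _; rewrite sum1dep_card.
  apply: leq_trans (card_exp_fibre y d0); apply/subset_leq_card/subsetP => x.
  by rewrite !inE => /andP[].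
apply/subset_leq_card/subsetP => _ /imsetP[x x0 ->]; rewrite !inE in x0 *.
by rewrite -exprM mulnC divnK // -(inj_eq (mulfI x0)) mulr1 -exprS -cF expf_card.
Qed.

(** For [d] dividing [n], the equation [x ^+ (n %/ d) = 1] singles out the [d]-th powers in the
    cyclic group of order [n]. The parameter [d] collects the powers imposed during
    inclusion-exclusion. *)
Definition sifted (A : F) (s : seq nat) (d : nat) : {set F} :=
  [set z | [&& z != 0, (z ^+ 2 * A) ^+ (n %/ d) == 1
             & all (fun l => (z ^+ 2 * A) ^+ (n %/ l) != 1) s]].

Lemma card_sifted_nil (A : F) (d : nat) : A != 0 -> (d %| n)%N ->
  (#|sifted A [::] d| <= 2 * (n %/ d))%N.
Proof.
move=> A0 dn; have m0 : (0 < n %/ d)%N by rewrite divn_gt0 ?(dvdn_gt0 n0) // dvdn_leq.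
apply: leq_trans (card_exp_fibre (A ^- (n %/ d)) (_ : 0 < 2 * (n %/ d))%N); last by lia.
apply/subset_leq_card/subsetP => z; rewrite !inE => /and3P[_ /eqP zA _].
have Am : A ^+ (n %/ d) != 0 by rewrite expf_neq0.
by apply/eqP/(mulIf Am); rewrite mulVf // exprM -exprMn zA.
Qed.

(** One step of Legendre's sieve: for coprime [d] and [l], a [d * l]-th power is the same as a
    [d]-th power that is also an [l]-th power. *)
Lemma sifted_cons (A : F) (l : nat) (s : seq nat) (d : nat) :
  (d %| n)%N -> (l %| n)%N -> coprime d l ->
  sifted A (l :: s) d = sifted A s d :\: sifted A s (d * l)%N
  /\ sifted A s (d * l)%N \subset sifted A s d.
Proof.
move=> dn ln cdl; have dln : (d * l %| n)%N by rewrite Gauss_dvd ?dn.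
have l0 := dvdn_gt0 n0 ln; have d0 := dvdn_gt0 n0 dn.
set m := (n %/ (d * l))%N.
have nd : (n %/ d = m * l)%N.
  by rewrite -[in LHS](divnK dln) mulnCA mulKn // mulnC.
have nl : (n %/ l = m * d)%N by rewrite -[in LHS](divnK dln) mulnA mulnK.
have key (x : F) : (x ^+ m == 1) = (x ^+ (n %/ d) == 1) && (x ^+ (n %/ l) == 1).
  apply/eqP/andP => [xm|[/eqP xd /eqP xl]].
    by rewrite nd nl !exprM xm !expr1n.
  by apply: coprime_exp_eq1 cdl _ _; rewrite -exprM -?nd -?nl.
split.
  apply/setP => z; rewrite !inE /= -/m key.
  by case: (z != 0) => //=; case: (_ ^+ (n %/ d) == 1); case: (_ ^+ (n %/ l) == 1);
    case: (all _ _).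
by apply/subsetP => z; rewrite !inE -/m key => /and3P[-> /andP[-> _] ->].
Qed.

Variables (e : F -> algC).
Hypotheses (eD : forall x y, e (x + y) = e x * e y) (e0 : e 0 = 1).
Hypotheses (eJ : forall x, (e x)^* = e (- x)) (e1 : e 1 != 1).

(** Before sifting, the set is invariant under at least [n %/ d] roots of unity and has at most
    [2 * (n %/ d)] elements, so [expsum_invariant_bound] yields the square root of [2 * n.+1]. Each
    sifting prime splits the sum in two and doubles the bound. *)
Lemma expsum_sifted (A a : F) (beta : nat) : A != 0 -> a != 0 ->
  (2 * n.+1 <= beta ^ 2)%N ->
  forall s d, uniq s -> all prime s -> all (dvdn^~ n) s -> all (coprime d) s ->
  (d %| n)%N -> `|expsum e (sifted A s d) a| <= (2 ^ size s * beta)%:R.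
Proof.
move=> A0 a0 b2; elim=> [|l s IH] d /=.
  move=> _ _ _ _ dn; rewrite expn0 mul1n.
  have m0 : (0 < n %/ d)%N by rewrite divn_gt0 ?(dvdn_gt0 n0) // dvdn_leq.
  have H0 : (0 : F) \notin [set w : F | w ^+ (n %/ d) == 1].
    by rewrite inE expr0n; case: (n %/ d)%N m0 => //= k _; rewrite eq_sym oner_eq0.
  have inv w z : w \in [set w : F | w ^+ (n %/ d) == 1] ->
      z \in sifted A [::] d -> w * z \in sifted A [::] d.
    rewrite !inE !andbT => /eqP w1 /andP[z0 /eqP z1]; apply/andP; split.
      by rewrite mulf_neq0 //; apply: contraNneq H0 => w0; rewrite inE -w0 w1.
    have -> : (w * z) ^+ 2 * A = w ^+ 2 * (z ^+ 2 * A) by rewrite exprMn mulrA.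
    by rewrite exprMn z1 mulr1 exprAC w1 expr1n.
  have := expsum_invariant_bound eD e0 eJ e1 a0 H0 inv.
  set x := `|_|; have x0 : 0 <= x by rewrite normr_ge0.
  move=> le; rewrite -(@ler_pXn2r _ 2) ?nnegrE ?ler0n // -natrX.
  apply: le_trans (_ : (2 * n.+1)%:R <= _); last by rewrite ler_nat.
  have m0' : 0 < (n %/ d)%:R :> algC by rewrite ltr0n.
  rewrite -(ler_pM2l m0'); apply: le_trans (_ : _ <= (#|F| * #|sifted A [::] d|)%:R) _.
    by apply: le_trans le; rewrite ler_wpM2r ?exprn_ge0 // ler_nat card_unity_roots.
  rewrite -natrM ler_nat cF.
  by apply: leq_trans (leq_mul (leqnn _) (card_sifted_nil A0 dn)) _; apply: eq_leq; ring.
case/andP=> ls us /andP[pl ps] /andP[ln sn] /andP[cdl cds] dn.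
have [-> sub] := sifted_cons A s dn ln cdl.
have -> : expsum e (sifted A s d :\: sifted A s (d * l)) a =
    expsum e (sifted A s d) a - expsum e (sifted A s (d * l)) a.
  rewrite /expsum [X in _ = X - _](big_setID (sifted A s (d * l))) /= (setIidPr sub).
  by rewrite addrAC subrr add0r.
apply: le_trans (ler_normB _ _) _; rewrite expnS -mulnA mulSn mul1n natrD.
apply: lerD; apply: IH => //; last by rewrite Gauss_dvd ?dn.
apply/allP => k ks; rewrite coprimeMl; apply/andP; split; first exact: (allP cds).
rewrite prime_coprime //; apply/negP; rewrite dvdn_prime2 //; last exact: (allP ps).
by move=> /eqP lk; rewrite lk ks in ls.
Qed.
End Sifting.

(** Each Euler factor [1 - 1 / l] is at least 1/2. *)
Lemma totient_lower_bound (n : nat) :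
  (0 < n)%N -> (n <= totient n * 2 ^ size (primes n))%N.
Proof.
move=> n0; rewrite totientE // {1}(prod_prime_decomp n0) prime_decompE big_map /=.
have : {in primes n, forall l, prime l && (0 < logn l n)%N}.
  by move=> l; rewrite mem_primes logn_gt0 mem_primes => /and3P[-> -> ->].
elim: (primes n) => [|l s IH] Hs; first by rewrite !big_nil.
have /andP[pl ll] := Hs l (mem_head _ _).
rewrite !big_cons expnS mulnACA leq_mul ?IH //; last by move=> k ks; apply: Hs; rewrite inE ks orbT.
rewrite -{1}(prednK ll) expnS mulnAC leq_mul2r; apply/orP; right.
by have := prime_gt1 pl; lia.
Qed.

(** A prime factor that is at least [2 ^ k] pays for its own factor [2 ^ k], and at most [2 ^ k]
    prime factors are smaller. *)
Lemma expn_omega_bound (n k : nat) :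
  (0 < n)%N -> ((2 ^ size (primes n)) ^ k <= (2 ^ k) ^ (2 ^ k) * n)%N.
Proof.
move=> n0; rewrite -expnM mulnC expnM.
apply: leq_trans (_ : (2 ^ k) ^ count (fun l => l < 2 ^ k) (primes n) *
   \prod_(l <- primes n) l <= _)%N.
  have : {in primes n, forall l, 0 < l}%N by move=> l; rewrite mem_primes => /andP[/prime_gt0].
  elim: (primes n) => [|l s IH] Hs; first by rewrite big_nil.
  have {}IH : ((2 ^ k) ^ size s <= (2 ^ k) ^ count (fun l => l < 2 ^ k) s * \prod_(l <- s) l)%N.
    by apply: IH => i si; apply: Hs; rewrite inE si orbT.
  rewrite big_cons /= expnS expnD.
  case: ltnP => lk.
    rewrite expn1 -mulnA leq_mul2l; apply/orP; right; apply: leq_trans IH _.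
    by rewrite leq_mul2l leq_pmull ?orbT // Hs ?mem_head.
  by rewrite expn0 mul1n mulnCA leq_mul.
apply: leq_mul; last first.
  apply: dvdn_leq => //; apply: prod_primes_dvdn (primes_uniq n) _ => l.
  by rewrite mem_primes => /and3P[].
rewrite leq_pexp2l ?expn_gt0 // -size_filter -[leqRHS](size_iota 0).
apply: uniq_leq_size; first by rewrite filter_uniq ?primes_uniq.
by move=> l; rewrite mem_filter mem_iota => /andP[].
Qed.

(** * Primitive elements of the form (x + y)^2 A *)

Definition prim_elt (F : fieldType) (n : nat) (x : F) : bool :=
  (x != 0) && all (fun l => x ^+ (n %/ l) != 1) (primes n).

Section PrimitiveElements.
Variables (F : finFieldType) (c : nat).
Hypotheses (pp : prime c.*2.+1) (cF : #|F| = c.*2.+1).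
Local Notation n := c.*2.

Let n0 : (0 < n)%N.
Proof. by rewrite double_gt0; apply: half_card_gt0 pp. Qed.

Lemma exists_prim_root : {g : F | n.-primitive_root g}.
Proof.
have /hasP/sig2_eqW[g _ prim_g] : has n.-primitive_root (enum [set~ (0 : F)]).
  apply: has_prim_root => //; rewrite ?enum_uniq //.
    apply/allP => x; rewrite mem_enum !inE => x0; rewrite unity_rootE.
    by rewrite -(inj_eq (mulfI x0)) mulr1 -exprS -cF expf_card.
  by rewrite -cardE cardsC1 cF.
by exists g.
Qed.

Lemma card_prim_elt : (totient n <= #|[set x : F | prim_elt n x]|)%N.
Proof.
have [g gP] := exists_prim_root.
have -> : totient n = #|[set u : 'I_n | coprime n u]|.
  rewrite totient_count_coprime big_mkord -sum1_card [RHS]big_mkcond /=.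
  by apply: eq_bigr => u _; rewrite inE; case: coprime.
rewrite -(card_in_imset (f := fun u : 'I_n => g ^+ u)); last first.
  move=> u v _ _ /eqP; rewrite (eq_prim_root_expr gP) !modn_small ?ltn_ord // => /eqP.
  exact: val_inj.
apply/subset_leq_card/subsetP => _ /imsetP[u cu ->]; rewrite !inE in cu *.
apply/andP; split.
  apply: expf_neq0; apply: contraTneq (oner_neq0 F) => g0.
  by rewrite negbK -(prim_expr_order gP) g0 expr0n (gtn_eqF n0).
apply/allP => l; rewrite mem_primes => /and3P[pl _ ln].
rewrite -exprM -(prim_order_dvd gP) -{1}(divnK ln) mulnC dvdn_pmul2r; last first.
  by rewrite divn_gt0 ?prime_gt0 // dvdn_leq.
apply/negP => lu; have : (l %| gcdn n u)%N by rewrite dvdn_gcd ln.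
by rewrite (eqP cu) Euclid_dvd1.
Qed.

Lemma half_power_square (x : F) : x ^+ c = 1 -> exists z, z ^+ 2 = x.
Proof.
move=> xc; have [g gP] := exists_prim_root.
have xn : x ^+ n = 1 by rewrite -addnn exprD xc mulr1.
have [i xi] := prim_rootP gP xn.
move: xc; rewrite {}xi; move: (nat_of_ord i) => {}i.
rewrite -exprM => /eqP; rewrite -(prim_order_dvd gP) -muln2 mulnC.
rewrite dvdn_pmul2r ?(half_card_gt0 pp) // => /dvdnP[j ij].
by exists (g ^+ j); rewrite -exprM -ij.
Qed.

(** A primitive [y] is a nonresidue, like [A], so [y / A] is a square; hence [z ^+ 2 * A] runs
    through all primitive elements. *)
Lemma card_sifted_primes (A : F) : qchar c A = -1 ->
  (n <= #|sifted n A (primes n) 1| * 2 ^ size (primes n))%N.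
Proof.
move=> chiA; apply: leq_trans (totient_lower_bound n0) _.
rewrite leq_mul2r; apply/orP; right; apply: leq_trans card_prim_elt _.
have A0 : A != 0 by apply: contra_eqN chiA => /eqP ->; rewrite qchar0.
apply: leq_trans (leq_imset_card (fun z => z ^+ 2 * A) _).
apply/subset_leq_card/subsetP => y; rewrite inE => /andP[y0 /allP yP].
have two_n : 2 \in primes n by rewrite mem_primes n0 -muln2 dvdn_mull.
have yc : y ^+ c = -1.
  case: (expf_half cF y0) => // yc; have := yP _ two_n.
  by rewrite -muln2 mulnK // yc eqxx.
have Ac : A ^+ c = -1 by case: (qcharP pp cF A0) => -[] // _; rewrite chiA.
have [z zE] : exists z, z ^+ 2 = y / A.
  by apply: half_power_square; rewrite exprMn exprVn yc Ac divff // oppr_eq0 oner_eq0.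
have yE : y = z ^+ 2 * A by rewrite zE divfK.
apply/imsetP; exists z => //; rewrite inE; apply/and3P; split.
- by apply: contraNneq y0 => z0; rewrite yE z0 expr0n mul0r.
- by rewrite divn1 -yE -(inj_eq (mulfI y0)) mulr1 -exprS -cF expf_card.
by apply/allP => l ln; rewrite -yE yP.
Qed.

Variables (e : F -> algC).
Hypotheses (eD : forall x y, e (x + y) = e x * e y) (e0 : e 0 = 1).
Hypotheses (eJ : forall x, (e x)^* = e (- x)) (e1 : e 1 != 1).

(** With [w = 2 ^ size (primes n)], the sifted set has at least [n / w] elements and its exponential
    sums off 0 are at most [w * beta], so [exists_sum_in] applies; the factor 2 absorbs the passage
    from [#|F|] to [n]. *)
Lemma exists_prim_elt_sum (A : F) (X : {set F}) (beta : nat) :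
  qchar c A = -1 -> (2 * c.*2.+1 <= beta ^ 2)%N ->
  (2 * (2 ^ size (primes n)) ^ 2 * beta < #|X|)%N ->
  exists x y, [/\ x \in X, y \in X & prim_elt n ((x + y) ^+ 2 * A)].
Proof.
move=> chiA b2; set w := (2 ^ size _)%N => ltX.
have A0 : A != 0 by apply: contra_eqN chiA => /eqP ->; rewrite qchar0.
have cS := card_sifted_primes chiA.
have SB a : a != 0 -> `|expsum e (sifted n A (primes n) 1) a| <= (w * beta)%:R.
  move=> a0; apply: (expsum_sifted n0 cF eD e0 eJ e1) => //; first exact: primes_uniq.
  - by apply/allP => l; rewrite mem_primes => /and3P[].
  - by apply/allP => l; rewrite mem_primes => /and3P[].
  by apply/allP => l; rewrite coprime1n.
have lt : (w * beta)%:R * #|F|%:R < (#|sifted n A (primes n) 1| * #|X|)%:R :> algC.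
  rewrite -natrM ltr_nat cF -(ltn_pmul2r (_ : 0 < w)%N); last by rewrite expn_gt0.
  apply: leq_trans (_ : n * #|X| <= _)%N; last by rewrite mulnAC leq_mul2r cS orbT.
  apply: leq_ltn_trans (_ : _ <= n * (2 * w ^ 2 * beta))%N _; last by rewrite ltn_pmul2l.
  rewrite (_ : n * _ = (w * beta) * (2 * n) * w)%N; last by ring.
  by rewrite leq_mul2r leq_mul2l; apply/orP; right; apply/orP; right; lia.
have [x [y [xX yX xyS]]] := exists_sum_in eD e0 eJ e1 (ler0n _ _) SB lt.
exists x, y; split=> //; move: xyS; rewrite inE => /and3P[xy0 _ xyP].
by rewrite /prim_elt mulf_neq0 ?expf_neq0.
Qed.
End PrimitiveElements.

(** * Small triples of nonresidual area *)

Lemma exists_addchar (p : nat) : prime p ->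
  exists e : 'F_p -> algC, [/\ forall x y, e (x + y) = e x * e y, e 0 = 1,
    forall x, (e x)^* = e (- x) & e 1 != 1].
Proof.
move=> pp; have [w wP] := C_prim_root_exists (prime_gt0 pp).
have eD (x y : 'F_p) : w ^+ (x + y)%R = w ^+ x * w ^+ y.
  have wP' : (Zp_trunc (pdiv p)).+2.-primitive_root w by rewrite (Fp_cast pp).
  by rewrite -exprD -[RHS](prim_expr_mod wP').
have w0 : w ^+ (0%R : 'F_p) = 1 by rewrite expr0.
exists (fun x => w ^+ x); split=> //.
  move=> x; have w1 : `|w| = 1.
    apply/eqP; rewrite -(@pexpr_eq1 _ _ p) ?prime_gt0 ?normr_ge0 //.
    by rewrite -normrX (prim_expr_order wP) normr1.
  have wx1 : `|w ^+ x| = 1 by rewrite normrX w1 expr1n.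
  have wx0 : w ^+ x != 0 by rewrite -normr_eq0 wx1 oner_eq0.
  by apply: (mulfI wx0); rewrite -normCK wx1 expr1n -eD subrr w0.
rewrite -[X in X != 1]/(w ^+ 1) -(prim_order_dvd wP).
by rewrite Euclid_dvd1.
Qed.

Lemma prim_elt_generator (F : finFieldType) (n : nat) (z : F) :
  #|F| = n.+1 -> (0 < n)%N -> prim_elt n z ->
  exists2 u : {unit F}, FinRing.uval u = z & generator [set: {unit F}] u.
Proof.
move=> cF n0 /andP[z0 /allP zP].
have zu : z \is a GRing.unit by rewrite unitfE.
exists (FinRing.unit F zu) => //; set u := FinRing.unit F zu.
have cU : #|[set: {unit F}]| = n by rewrite card_finField_unit cF.
have un : (#[u]%g %| n)%N by rewrite -cU order_dvdG ?inE.
rewrite /generator eq_sym eqEcard subsetT /= cU.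
rewrite -[#|_|]/(#[u]%g) leqNgt; apply/negP => lt.
have q1 : (1 < n %/ #[u]%g)%N by rewrite ltn_divRL // mul1n.
have lq := pdiv_dvd (n %/ #[u]%g); have pl := pdiv_prime q1.
set l := pdiv _ in lq pl.
have ln : (l %| n)%N by apply: dvdn_trans lq _; rewrite -{2}(divnK un) dvdn_mulr.
have /zP/eqP[] : l \in primes n by rewrite mem_primes pl n0.
have : (u ^+ (n %/ l))%g = 1%g.
  apply/eqP; rewrite -order_dvdn dvdn_divRL //.
  by rewrite -(divnK un) mulnC dvdn_mul.
by move/(congr1 FinRing.uval); rewrite FinRing.val_unitX.
Qed.

Lemma exists_nonres_area (F : finFieldType) (c Y : nat) :
  prime c.*2.+1 -> #|F| = c.*2.+1 -> (5 <= Y)%N -> (Y < c.*2.+1)%N ->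
  (exists2 n, (0 < n <= Y)%N & qchar c (n%:R : F) = -1) ->
  exists u v : nat, [/\ (0 < v < u)%N, (u ^ 2 + v ^ 2 <= Y ^ 2)%N
    & qchar c ((u * v * (u - v) * (u + v))%N%:R : F) = -1].
Proof.
move=> pp cF Y5 Yp [n0 n0Y chin0].
have qM (m n : nat) : qchar c ((m * n)%N%:R : F) = qchar c (m%:R : F) * qchar c (n%:R : F).
  by rewrite natrM (qcharM pp cF).
have pm1 (m : nat) : (0 < m < c.*2.+1)%N ->
    qchar c (m%:R : F) = 1 \/ qchar c (m%:R : F) = -1.
  by move=> /(natf_small_neq0 pp cF) /(qcharP pp cF) [[_]|[_]]; [left|right].
have ex : exists n, (0 < n)%N && (qchar c (n%:R : F) == -1).
  by exists n0; rewrite chin0 eqxx; case/andP: n0Y => ->.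
have [q /andP[q0 /eqP chiq] qmin] := ex_minnP ex.
have qY : (q <= Y)%N.
  by apply: leq_trans (qmin n0 _) _; case/andP: n0Y => // ->; rewrite chin0.
have below m : (0 < m < q)%N -> qchar c (m%:R : F) = 1.
  move=> /andP[m0 mq]; case: (pm1 m) => // [|chim]; first by rewrite m0; lia.
  by have := qmin m; rewrite m0 chim eqxx => /(_ isT); lia.
have [q1|q1] := leqP q 1.
  by move: chiq; rewrite (_ : q = 1%N) ?qchar1; lia.
have [q2|q2] := leqP q 2.
  have {}q2 : q = 2 by lia.
  rewrite q2 in chiq.
  have Y2 : (25 <= Y ^ 2)%N by rewrite (@leq_exp2r 5 Y 2).
  (* The areas 6, 60 and 30 come from [(2, 1)], [(4, 1)] and [(3, 2)]; the characters of 3 and 5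
     decide which one is a nonresidue. *)
  case: (pm1 3%N); first by lia.
    move=> chi3; exists 2%N, 1%N; split=> //; first by lia.
    by rewrite (_ : (_ * _)%N = (2 * 3)%N) // qM chiq chi3.
  move=> chi3; case: (pm1 5%N); first by lia.
    move=> chi5; exists 4%N, 1%N; split=> //; first by lia.
    by rewrite (_ : (_ * _)%N = (2 * 2 * 3 * 5)%N) // !qM chiq chi3 chi5.
  move=> chi5; exists 3%N, 2%N; split=> //; first by lia.
  by rewrite (_ : (_ * _)%N = (2 * 3 * 5)%N) // !qM chiq chi3 chi5.
(* The area is [(q - 1) * (q - 2) * q], whose first two factors are residues by minimality of
   [q]. *)
exists q.-1, 1%N; split; first by lia.
  by apply: (@leq_trans (q ^ 2)%N); [nia | rewrite leq_exp2r].
rewrite addn1 prednK // muln1 !qM chiq !below //; lia.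
Qed.

Lemma exists_prim_area : exists X0 : nat, forall p : nat, prime p -> (X0 <= p)%N ->
  exists k u v : nat, [/\ (0 < k)%N, (0 < v < u)%N, (k * (u ^ 2 + v ^ 2) < p)%N
    & prim_elt p.-1 ((k ^ 2 * (u * v * (u - v) * (u + v)))%N%:R : 'F_p)].
Proof.
have [a a512] : exists a, (512 <= a)%N by exists 512%N.
set M := (4 * a + 4)%N.
set C1 := moment_const a.*2.+2 (2 ^ M).
set C2 := ((2 ^ (4 * M)) ^ (2 ^ (4 * M)))%N.
(* This forces [8 * C1 < 2 ^ s], as [small_nonresidue] requires, and [C2 * 2 ^ (M + 5) < 2 ^ s],
   which will absorb the loss from the sieve. *)
set s0 := (8 * C1 + C2 * 2 ^ (M + 5) + 2)%N.
have M1 : (1 < 2 ^ M)%N by rewrite -{1}(expn0 2) ltn_exp2l // /M; lia.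
exists ((2 ^ M) ^ s0)%N => p pp Xp.
have := trunc_log_bounds M1 (prime_gt0 pp) => /=.
have := trunc_log_max M1 Xp; set s := trunc_log _ _ => ss0 /andP[tp pt].
have st : (s < 2 ^ s)%N by apply: ltn_expl.
have s2 : (2 <= s)%N by apply: leq_trans ss0; rewrite /s0 leq_addl.
have C1s : (8 * C1 < 2 ^ s)%N by lia.
have C2s : (C2 * 2 ^ (M + 5) < 2 ^ s)%N by lia.
rewrite -!expnM ![(M * _)%N]mulnC in tp pt.
have two_expn x y : (x < y -> 2 ^ x < 2 ^ y)%N by move=> xy; rewrite ltn_exp2l.
have p2 : (2 < p)%N.
  by apply: leq_trans tp; apply: (two_expn 1%N); rewrite /M; nia.
have [c pE] : exists c, p = c.*2.+1.
  by exists p./2; case: (even_prime pp) => [p2'|op]; [lia | rewrite -[LHS]odd_double_half op].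
subst p; clear Xp; set F := 'F_(c.*2.+1).
have cF : #|F| = c.*2.+1 by apply: card_Fp.
have pM : (2 ^ (s * M) <= c.*2.+1 <= 2 ^ (s.+1 * M))%N by rewrite tp ltnW.
have nr := small_nonresidue pp cF a512 C1s pM.
set Y := (2 ^ (s * a))%N in nr.
have Y5 : (5 <= Y)%N by apply: (@two_expn 2%N); nia.
have Yp : (Y < c.*2.+1)%N by apply: leq_trans tp; apply: two_expn; rewrite /M; nia.
have [u [v [uv uvY chiA]]] := exists_nonres_area pp cF Y5 Yp nr.
have [e [eD e0 eJ e1]] := exists_addchar pp.
(* With [t = 2 ^ s], [K = t ^ (2 * a + 3)] exceeds [beta] by a factor [t] up to constants, enough to
   beat [w ^ 2], while [2 * K * Y ^ 2 = 2 * t ^ (4 * a + 3)] is still below [p]. *)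
pose K := (2 ^ (s * a.*2.+3))%N.
pose beta := (2 ^ (s.+1 * a.*2.+2).+1)%N.
have b2 : (2 * c.*2.+1 <= beta ^ 2)%N.
  rewrite -expnM; apply: leq_trans (leq_mul (leqnn 2) (ltnW pt)) _.
  by rewrite -expnS leq_exp2l // /M; nia.
have Kp : (K < c.*2.+1)%N by apply: leq_trans tp; apply: two_expn; rewrite /M; nia.
pose X : {set F} := [set (i.+1)%:R | i : 'I_K].
have cX : #|X| = K.
  rewrite card_imset ?card_ord // => i j ij; apply/val_inj/succn_inj.
  apply: (natf_small_inj pp cF) ij.
    exact: leq_ltn_trans (ltn_ord i) Kp.
  exact: leq_ltn_trans (ltn_ord j) Kp.
have n0 : (0 < c.*2)%N by lia.
set w := (2 ^ size (primes c.*2))%N.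
(* The case [k = 4 * M] of [expn_omega_bound]: [p - 1] is below [(2 * t) ^ M], and an [M]-th root is
   taken after weakening [C2] to [C2 ^ M]. *)
have w4 : (w ^ 4 <= C2 * 2 ^ s.+1)%N.
  rewrite -(@leq_exp2r _ _ M); last by rewrite /M; lia.
  rewrite -expnM; apply: leq_trans (expn_omega_bound (4 * M) n0) _.
  rewrite expnMn -/C2 leq_mul //.
    by rewrite -[leqLHS]expn1 leq_pexp2l ?expn_gt0 // /M; lia.
  by rewrite -expnM; apply: leq_trans (ltnW pt).
have wK : (2 * w ^ 2 * beta < #|X|)%N.
  rewrite cX -(@ltn_exp2r _ _ 2) //.
  have -> : ((2 * w ^ 2 * beta) ^ 2 = 4 * w ^ 4 * beta ^ 2)%N by ring.
  apply: leq_ltn_trans (_ : 4 * (C2 * 2 ^ s.+1) * beta ^ 2 < _)%N.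
    by rewrite leq_mul2r leq_mul2l w4 !orbT.
  have -> : (4 * (C2 * 2 ^ s.+1) * beta ^ 2 = C2 * 2 ^ (M + 5) * 2 ^ s * 2 ^ (s * M))%N.
    rewrite [(4 * _)%N]mulnCA -!mulnA /beta; congr (C2 * _)%N.
    by rewrite -!expnM -!expnD -[4%N]/(2 ^ 2)%N -expnD; congr (2 ^ _)%N; rewrite /M; lia.
  have -> : (K ^ 2 = 2 ^ s * 2 ^ s * 2 ^ (s * M))%N.
    by rewrite /K -expnM -!expnD; congr (2 ^ _)%N; rewrite /M; lia.
  by rewrite !ltn_pmul2r ?expn_gt0.
have [_ [_ [/imsetP[i _ ->] /imsetP[j _ ->] prim]]] :=
  exists_prim_elt_sum pp cF eD e0 eJ e1 chiA b2 wK.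
exists (i.+1 + j.+1)%N, u, v; split=> //.
  apply: leq_trans tp; apply: (@leq_ltn_trans (K.*2 * Y ^ 2)).
    by apply: leq_mul => //; have := ltn_ord i; have := ltn_ord j; lia.
  rewrite /K /Y -mul2n -expnM -expnS -expnD; apply: two_expn; rewrite /M; nia.
by rewrite natrM natrX natrD.
Qed.

(** * From areas to Pythagorean triples *)

Lemma scaled_triple (k u v : nat) : (0 < k)%N -> (0 < v < u)%N ->
  pythagorean_triple (k * (u ^ 2 - v ^ 2))%N%:Z (2 * k * u * v)%N%:Z (k * (u ^ 2 + v ^ 2))%N%:Z.
Proof.
move=> k0 /andP[v0 vu]; have [w ->] : exists w, u = (v + w.+1)%N by exists (u - v.+1)%N; lia.
have -> : ((v + w.+1) ^ 2 - v ^ 2 = w.+1 * (2 * v + w.+1))%N.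
  by rewrite subn_sqr addKn; congr (_ * _)%N; lia.
split; rewrite ?ltz_nat ?muln_gt0 ?addn_gt0 ?expn_gt0 ?k0 ?v0 ?orbT //.
by rewrite !expr2 -!PoszM -PoszD; congr Posz; ring.
Qed.

Lemma scaled_triple_area (k u v : nat) :
  (((k * (u ^ 2 - v ^ 2))%N%:Z * (2 * k * u * v)%N%:Z) %/ 2)%Z =
    (k ^ 2 * (u * v * (u - v) * (u + v)))%N%:Z.
Proof.
rewrite subn_sqr -PoszM.
have -> : (k * ((u - v) * (u + v)) * (2 * k * u * v) =
    k ^ 2 * (u * v * (u - v) * (u + v)) * 2)%N by ring.
by rewrite PoszM mulzK.
Qed.

Theorem theorem1p1 (R : realType) :
  exists x0 : R, forall p : nat, prime p -> x0 <= p%:R ->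
    exists a b c : int,
      [/\ pythagorean_triple a b c,
          a < p%:Z, b < p%:Z, c < p%:Z
        & primitive_root p ((a * b) %/ 2)%Z].
Proof.
have [X0 HX0] := exists_prim_area.
exists X0%:R => p pp; rewrite ler_nat => /(HX0 p pp)[k [u [v [k0 uv cp prim]]]].
exists (k * (u ^ 2 - v ^ 2))%N%:Z, (2 * k * u * v)%N%:Z, (k * (u ^ 2 + v ^ 2))%N%:Z.
split; first exact: scaled_triple.
- by rewrite ltz_nat; apply: leq_ltn_trans cp; rewrite leq_mul2l; lia.
- rewrite ltz_nat; apply: leq_ltn_trans cp.
  by have : (2 * (u * v) <= u ^ 2 + v ^ 2)%N by [exact: nat_Cauchy]; nia.
- by rewrite ltz_nat.
rewrite scaled_triple_area /primitive_root -pmulrn.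
apply: prim_elt_generator prim; first by rewrite card_Fp // prednK ?prime_gt0.
by rewrite -subn1 subn_gt0 prime_gt1.
Qed.
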